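(* Let $n\ge3$, $r\ge2$, $2\le k\le n-1$. Suppose (i) $Y$ has a continuous distribution function $G$ on $[l_G,r_G]$; (ii) $T$ is continuous and strictly increasing on $(l_G,r_G)$, with $\tau=\lim_{y\to l_G^+}T(y)>-\infty$ and $\lim_{y\to r_G^-}T(y)=\infty$; (iii) $h^{(k+r-1)}$ is continuous on $(\tau,\infty)$. Assume ${}_rM_{k-1}(\tau,T(t))\ne0$ for all $t\in(l_G,r_G)$. Then both \[ E[h^{(k+r-1)}(T(Y(n)))\mid Y(n-k)=s,\ Y(n+r)=t]=\frac{(k+r-1)!}{(k-1)!(r-1)!}\,{}_{r-1}M_{k-1}(T(s),T(t))\quad(l_G<s<t<r_G) \] and \[ E[h^{(k+r-1)}(T(Y(n)))\mid Y(n-k+1)=s_2,\ Y(n+r)=t]=\frac{(k+r-2)!}{(k-2)!(r-1)!}\,{}_{r-1}M'_{k-2}(T(s_2),T(t))\quad(l_G<s<s_2<t<r_G) \] hold if and only if $G(y)=1-e^{-c[T(y)-\tau]}$ for $l_G<y<r_G$, for some constant $c>0$.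
   Context: $Y_1,Y_2,\dots$ are i.i.d. copies of $Y$ with distribution function $G$; $l_G=\inf\{y:G(y)>0\}$, $r_G=\sup\{y:G(y)<1\}$. Upper record times $L(1)=1$, $L(m)=\min\{j>L(m-1):Y_j>Y_{L(m-1)}\}$, record values $Y(m)=Y_{L(m)}$. With $R(y)=-\ln(1-G(y))$, conditional expectations given $Y(n-k)=s$, $Y(n+r)=t$ use the conditional density of $Y(n)$: $\frac{(k+r-1)!}{(k-1)!(r-1)!}[\frac{R(x)-R(s)}{R(t)-R(s)}]^{k-1}[\frac{R(t)-R(x)}{R(t)-R(s)}]^{r-1}\frac{R'(x)}{R(t)-R(s)}$, $s<x<t$. For $h$, $M(x,y)=\frac{h(y)-h(x)}{y-x}$, $M'(x,y)=\frac{h'(y)-h'(x)}{y-x}$ ($x\ne y$), ${}_iM_j(x,y)=\frac{\partial^{i+j}}{\partial x^i\partial y^j}M(x,y)$, ${}_iM'_j$ analogously for $M'$, evaluated at $x=T(s)$, $y=T(t)$ when written with arguments $T(s),T(t)$. *)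

(* Defs.v *)
From Stdlib Require Import Reals Lra ClassicalEpsilon Factorial.
Open Scope R_scope.

(* The derivative of f at x (when it exists; an arbitrary value otherwise). *)
Definition Deriv (f : R -> R) (x : R) : R :=
  epsilon (inhabits 0) (fun l => derivable_pt_lim f x l).

Fixpoint Dn (n : nat) (f : R -> R) : R -> R :=
  match n with
  | O => f
  | S m => Deriv (Dn m f)
  end.

Definition Dxy (i j : nat) (F : R -> R -> R) (x y : R) : R :=
  Dn i (fun x' => Dn j (fun y' => F x' y') y) x.

Definition M (h : R -> R) (x y : R) : R := (h y - h x) / (y - x).
Definition M' (h : R -> R) (x y : R) : R := M (Deriv h) x y.

Definition right_lim (f : R -> R) (a L : R) : Prop :=
  forall eps, 0 < eps -> exists delta, 0 < delta /\
    forall x, a < x < a + delta -> Rabs (f x - L) < eps.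

Definition is_cdf (G : R -> R) : Prop :=
  (forall x y, x <= y -> G x <= G y) /\
  (forall x, forall eps, 0 < eps -> exists delta, 0 < delta /\
      forall y, x <= y < x + delta -> Rabs (G y - G x) < eps) /\
  (forall eps, 0 < eps -> exists A, forall x, x < A -> Rabs (G x) < eps) /\
  (forall eps, 0 < eps -> exists A, forall x, A < x -> Rabs (G x - 1) < eps).

(* l_G = inf {y : G y > 0};  "l_G < y" unfolds to: some z < y has G z > 0
   (this also covers l_G = -infinity). *)
Definition lG_lt (G : R -> R) (y : R) : Prop := exists z, 0 < G z /\ z < y.
(* r_G = sup {y : G y < 1};  "y < r_G" unfolds to: some z > y has G z < 1. *)
Definition lt_rG (G : R -> R) (y : R) : Prop := exists z, G z < 1 /\ y < z.
Definition in_I (G : R -> R) (y : R) : Prop := lG_lt G y /\ lt_rG G y.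

Definition RG (G : R -> R) (y : R) : R := - ln (1 - G y).

Fixpoint rs_sum (f g : R -> R) (p xi : nat -> R) (m : nat) : R :=
  match m with
  | O => 0
  | S m' => rs_sum f g p xi m' + f (xi m') * (g (p (S m')) - g (p m'))
  end.

Definition tagged_partition (a b : R) (m : nat) (p xi : nat -> R) : Prop :=
  p O = a /\ p m = b /\
  forall i, (i < m)%nat -> p i < p (S i) /\ p i <= xi i <= p (S i).

Definition RS_integral (f g : R -> R) (a b I : R) : Prop :=
  forall eps, 0 < eps -> exists delta, 0 < delta /\
    forall m p xi, tagged_partition a b m p xi ->
      (forall i, (i < m)%nat -> p (S i) - p i < delta) ->
      Rabs (rs_sum f g p xi m - I) < eps.

(* Conditional density of Y(n) given Y(n-a) = s, Y(n+b) = t, divided by R'(x):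
   (a+b-1)!/((a-1)!(b-1)!) [(R x - R s)/(R t - R s)]^(a-1)
                           [(R t - R x)/(R t - R s)]^(b-1) / (R t - R s)   *)
Definition cond_weight (a b : nat) (G : R -> R) (s t x : R) : R :=
  let R := RG G in
  INR (fact (a + b - 1)) / (INR (fact (a - 1)) * INR (fact (b - 1))) *
  ((R x - R s) / (R t - R s)) ^ (a - 1) *
  ((R t - R x) / (R t - R s)) ^ (b - 1) / (R t - R s).

(* E[phi(Y(n)) | Y(n-a) = s, Y(n+b) = t]
   = int_s^t phi(x) * density(x) dx, written as a Stieltjes integral  d R(x)
   (the density contains the factor R'(x)). *)
Definition CondExp (a b : nat) (G : R -> R) (phi : R -> R) (s t : R) : R :=
  epsilon (inhabits 0)
    (fun I => RS_integral (fun x => phi x * cond_weight a b G s t x) (RG G) s t I).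

(* Main.v *)
(* In the variable u = T(y), let Q(u) = -ln(1 - G(y)); the claim is that Q is linear on
   (tau, oo).  With N_j(x,y) = int_x^y g(u) (Q(u)-Q(x))^j (Q(y)-Q(u))^(r-1) dQ(u) and
   g = h^(k+r-1), the two identities read
     N_(k-1) = (Q(y)-Q(x))^(k+r-1) m   and   N_(k-2) = (Q(y)-Q(x))^(k+r-2) m',
   where m = _(r-1)M_(k-1) and m' = _(r-1)M'_(k-2) are the same integrals for Q = id.
   Since dN_(k-1) = -(k-1) N_(k-2) dQ(x), the case Q = id gives
     (y-x) m_x = (k+r-1) m - (k-1) m',
   and the general case then gives (y-x) m_x dQ(x) = (Q(y)-Q(x)) m_x dx.  Where m_x <> 0, in
   particular near tau, Q is therefore differentiable in x (which is not assumed) with slope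
   the secant slope to y, so that Q(y) - Q(x) is linear in x near tau, for every y; letting
   x tend to tau identifies Q.  Conversely, for linear Q both identities are the integral
   representation of the derivatives of M(x,y) = int_0^1 h'(x + (y-x) v) dv. *)

From Coquelicot Require Import Coquelicot.
Require Import Defs.
From Stdlib Require Import Reals Ranalysis5 ClassicalEpsilon Factorial Lra Lia.
Open Scope R_scope.
Set Bullet Behavior "Strict Subproofs".

(** Two obstacles shape the proof. First, [Q] is only known to be continuous and nondecreasing, so
    it may have plateaus as well as points without derivative. Errors are therefore measured in
    powers of Q(x') - Q(x) instead of x' - x: the differential relations of the overview become
    expansions with remainder O((Q(x') - Q(x))^2). On a plateau the density contains a division by
    R(t) - R(s) = 0, which returns zero, so the two identities reduce to m = m' = 0; this forces m_x
    = 0 and is excluded wherever m_x is nonzero. Second, m already contains h^(k+r-1), which is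
    merely continuous, so m_x cannot be obtained by differentiating under the integral sign. It
    exists because the factor (u - x)^(k-1), with k >= 2, vanishes at the moving endpoint:
    differentiation lowers this exponent and leaves h alone. *)

Lemma IVT_between (f : R -> R) (a b v : R) :
  a <= b -> (forall x, a <= x <= b -> continuity_pt f x) -> f a <= v <= f b ->
  exists z, a <= z <= b /\ f z = v.
Proof.
  intros Hab Hc [Ha Hb].
  destruct (Req_dec (f a) v) as [E|Na]; [exists a; split; [lra|easy]|].
  destruct (Req_dec (f b) v) as [E|Nb]; [exists b; split; [lra|easy]|].
  destruct (Req_dec a b) as [E|Nab]; [subst b; lra|].
  destruct (IVT_interv (fun x => f x - v) a b) as [z [Hz Ez]]; try lra.
  - intros x Hx. apply continuity_pt_minus; [now apply Hc|].
    apply continuity_pt_const. intros ? ?; reflexivity.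
  - exists z. split; [easy|lra].
Qed.

Lemma continuous_bounded (f : R -> R) (a b : R) :
  a <= b -> (forall x, a <= x <= b -> continuity_pt f x) ->
  exists K, 0 <= K /\ forall x, a <= x <= b -> Rabs (f x) <= K.
Proof.
  intros Hab Hc.
  destruct (continuity_ab_maj (fun x => Rabs (f x)) a b Hab) as [m [Hm _]].
  - intros c Hi. apply (continuity_pt_comp f Rabs); [now apply Hc|].
    apply Rcontinuity_abs.
  - exists (Rabs (f m)). split; [apply Rabs_pos|easy].
Qed.

Lemma RInt_Rabs_le (f : R -> R) (a b K : R) :
  ex_RInt f a b -> (forall t, Rmin a b <= t <= Rmax a b -> Rabs (f t) <= K) ->
  Rabs (RInt f a b) <= K * Rabs (b - a).
Proof.
  intros Hex Hb. destruct (Rle_dec a b) as [Hab|Hab].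
  - rewrite Rmin_left, Rmax_right in Hb by lra.
    rewrite (Rabs_pos_eq (b - a)) by lra. rewrite Rmult_comm.
    now apply abs_RInt_le_const.
  - rewrite Rmin_right, Rmax_left in Hb by lra.
    rewrite <- opp_RInt_swap by (now apply ex_RInt_swap).
    unfold opp; simpl. rewrite Rabs_Ropp, (Rabs_left (b - a)) by lra.
    replace (K * - (b - a)) with ((a - b) * K) by ring.
    apply abs_RInt_le_const; [lra| now apply ex_RInt_swap|easy].
Qed.

(** * Riemann-Stieltjes integrals *)

Lemma tagged_partition_le (a b : R) (m : nat) (p xi : nat -> R) :
  tagged_partition a b m p xi ->
  forall j, (j <= m)%nat -> a <= p j <= b.
Proof.
  intros (H0 & Hm & Hi) j Hj.
  assert (Hmon : forall d i, (i + d <= m)%nat -> p i <= p (i + d)%nat).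
  { induction d as [|d IH]; intros i Hid; [rewrite Nat.add_0_r; lra|].
    apply Rle_trans with (p (i + d)%nat); [apply IH; lia|].
    rewrite Nat.add_succ_r. destruct (Hi (i + d)%nat) as [H _]; [lia|lra]. }
  split.
  - rewrite <- H0. apply (Hmon j 0%nat); lia.
  - rewrite <- Hm. replace m with (j + (m - j))%nat by lia. apply Hmon; lia.
Qed.

Lemma rs_sum_ext (f1 f2 g1 g2 : R -> R) (a b : R) (m : nat) (p xi : nat -> R) :
  tagged_partition a b m p xi ->
  (forall x y z, a <= x <= b -> a <= y <= b -> a <= z <= b ->
     f1 x * (g1 z - g1 y) = f2 x * (g2 z - g2 y)) ->
  rs_sum f1 g1 p xi m = rs_sum f2 g2 p xi m.
Proof.
  intros Hp Hext.
  assert (H : forall j, (j <= m)%nat -> rs_sum f1 g1 p xi j = rs_sum f2 g2 p xi j).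
  { induction j as [|j IH]; intros Hj; [reflexivity|].
    simpl. rewrite IH by lia. f_equal.
    pose proof (tagged_partition_le _ _ _ _ _ Hp) as Hle.
    assert (H1 := Hle j ltac:(lia)). assert (H2 := Hle (S j) Hj).
    destruct Hp as (_ & _ & Hi). destruct (Hi j) as [_ Hx]; [lia|].
    apply Hext; lra. }
  now apply H.
Qed.

(** Comparing the products of integrand and increment, rather than the two functions separately,
    lets a constant factor move from the integrator to the integrand. *)
Lemma RS_integral_ext (f1 f2 g1 g2 : R -> R) (a b I : R) :
  (forall x y z, a <= x <= b -> a <= y <= b -> a <= z <= b ->
     f1 x * (g1 z - g1 y) = f2 x * (g2 z - g2 y)) ->
  RS_integral f1 g1 a b I -> RS_integral f2 g2 a b I.
Proof.
  intros Hext H eps He. destruct (H eps He) as [d [Hd Hs]].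
  exists d. split; [easy|]. intros m p xi Hp Hmesh.
  rewrite <- (rs_sum_ext _ _ _ _ _ _ _ _ _ Hp Hext). now apply Hs.
Qed.

Lemma RS_integral_minus (f g1 g2 : R -> R) (a b I1 I2 : R) :
  RS_integral f g1 a b I1 -> RS_integral f g2 a b I2 ->
  RS_integral f (fun x => g1 x - g2 x) a b (I1 - I2).
Proof.
  intros H1 H2 eps He.
  destruct (H1 (eps / 2)) as [d1 [Hd1 Hs1]]; [lra|].
  destruct (H2 (eps / 2)) as [d2 [Hd2 Hs2]]; [lra|].
  exists (Rmin d1 d2). split; [now apply Rmin_pos|]. intros m p xi Hp Hmesh.
  assert (E : rs_sum f (fun x => g1 x - g2 x) p xi m
              = rs_sum f g1 p xi m - rs_sum f g2 p xi m).
  { clear Hp Hmesh. induction m as [|m IH]; simpl; [ring|]. rewrite IH. ring. }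
  rewrite E.
  specialize (Hs1 m p xi Hp). specialize (Hs2 m p xi Hp).
  replace (_ - _ - (I1 - I2))
    with ((rs_sum f g1 p xi m - I1) - (rs_sum f g2 p xi m - I2)) by ring.
  eapply Rle_lt_trans; [apply Rabs_triang|]. rewrite Rabs_Ropp.
  assert (Rabs (rs_sum f g1 p xi m - I1) < eps / 2).
  { apply Hs1. intros i Hi. eapply Rlt_le_trans; [now apply Hmesh|apply Rmin_l]. }
  assert (Rabs (rs_sum f g2 p xi m - I2) < eps / 2).
  { apply Hs2. intros i Hi. eapply Rlt_le_trans; [now apply Hmesh|apply Rmin_r]. }
  lra.
Qed.

(** [RS_integral] only quantifies over fine partitions; their existence is what lets uniqueness and
    bounds be read off from it. The witness is the uniform partition with left tags. *)
Lemma fine_tagged_partition (a b d : R) :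
  a < b -> 0 < d ->
  exists m p xi, tagged_partition a b m p xi /\
    forall i, (i < m)%nat -> p (S i) - p i < d.
Proof.
  intros Hab Hd.
  destruct (archimed_cor1 (d / (b - a))) as [N [HN HN0]].
  { apply Rdiv_lt_0_compat; lra. }
  assert (HNp : 0 < INR N) by (apply lt_0_INR; lia).
  assert (Hstep : forall i,
    a + INR (S i) * ((b - a) / INR N) - (a + INR i * ((b - a) / INR N)) = (b - a) / INR N).
  { intros i. rewrite S_INR. ring. }
  assert (Hpos : 0 < (b - a) / INR N) by (apply Rdiv_lt_0_compat; lra).
  exists N, (fun i => a + INR i * ((b - a) / INR N)),
    (fun i => a + INR i * ((b - a) / INR N)).
  split; [split; [|split]|].
  - simpl. ring.
  - field. lra.
  - intros i _. specialize (Hstep i). split; lra.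
  - intros i _. rewrite Hstep. unfold Rdiv in *.
    apply Rmult_lt_compat_l with (r := b - a) in HN; [|lra].
    replace ((b - a) * (d * / (b - a))) with d in HN by (field; lra). lra.
Qed.

(** [CondExp] is chosen by [epsilon], so an integral once computed can be identified with it only
    through uniqueness. *)
Lemma RS_integral_unique (f g : R -> R) (a b I J : R) :
  a < b -> RS_integral f g a b I -> RS_integral f g a b J -> I = J.
Proof.
  intros Hab HI HJ.
  destruct (Req_dec I J) as [E|NE]; [easy|exfalso].
  assert (He : 0 < Rabs (I - J) / 2).
  { apply Rdiv_lt_0_compat; [apply Rabs_pos_lt; lra|lra]. }
  destruct (HI _ He) as [d1 [Hd1 Hs1]]. destruct (HJ _ He) as [d2 [Hd2 Hs2]].
  destruct (fine_tagged_partition a b (Rmin d1 d2) Hab) as (m & p & xi & Hp & Hmesh).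
  { now apply Rmin_pos. }
  specialize (Hs1 m p xi Hp). specialize (Hs2 m p xi Hp).
  assert (H1 : Rabs (rs_sum f g p xi m - I) < Rabs (I - J) / 2).
  { apply Hs1. intros i Hi. eapply Rlt_le_trans; [now apply Hmesh|apply Rmin_l]. }
  assert (H2 : Rabs (rs_sum f g p xi m - J) < Rabs (I - J) / 2).
  { apply Hs2. intros i Hi. eapply Rlt_le_trans; [now apply Hmesh|apply Rmin_r]. }
  assert (H3 := Rabs_triang (rs_sum f g p xi m - J) (- (rs_sum f g p xi m - I))).
  rewrite Rabs_Ropp in H3.
  replace (_ - J + - (_ - I)) with (I - J) in H3 by ring. lra.
Qed.

Lemma RS_integral_bound (f g : R -> R) (a b I K : R) :
  a < b -> (forall x y, a <= x -> x <= y -> y <= b -> g x <= g y) ->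
  (forall x, a <= x <= b -> Rabs (f x) <= K) ->
  RS_integral f g a b I -> Rabs I <= K * (g b - g a).
Proof.
  intros Hab Hg Hf HI. apply Rnot_lt_le. intros Hlt.
  destruct (HI (Rabs I - K * (g b - g a))) as [d [Hd Hs]]; [lra|].
  destruct (fine_tagged_partition a b d Hab Hd) as (m & p & xi & Hp & Hmesh).
  specialize (Hs m p xi Hp Hmesh).
  assert (Hle := tagged_partition_le _ _ _ _ _ Hp).
  assert (Hb : forall j, (j <= m)%nat ->
            Rabs (rs_sum f g p xi j) <= K * (g (p j) - g (p O))).
  { induction j as [|j IH]; intros Hj; simpl.
    - rewrite Rabs_R0. lra.
    - eapply Rle_trans; [apply Rabs_triang|].
      assert (H1 := Hle j ltac:(lia)). assert (H2 := Hle (S j) Hj).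
      destruct Hp as (_ & _ & Hi). destruct (Hi j) as [H3 H4]; [lia|].
      assert (H5 : g (p j) <= g (p (S j))) by (apply Hg; lra).
      assert (Hx := Hf (xi j) ltac:(lra)).
      rewrite Rabs_mult, (Rabs_pos_eq (g _ - g _)) by lra.
      specialize (IH ltac:(lia)).
      apply Rmult_le_compat_r with (r := g (p (S j)) - g (p j)) in Hx; lra. }
  specialize (Hb m (Nat.le_refl m)).
  destruct Hp as (E0 & Em & _). rewrite E0, Em in Hb.
  assert (H3 := Rabs_triang (rs_sum f g p xi m) (- (rs_sum f g p xi m - I))).
  rewrite Rabs_Ropp in H3.
  replace (_ + - (_ - I)) with I in H3 by ring. lra.
Qed.

(** Substitution v = g(x). By the intermediate value theorem every v between g(p_i) and g(p_(i+1))
    is some g(z), where phi(v) = f(z) is close to f at the tag by uniform continuity. The integrand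
    has to factor through g, hence be constant on plateaus of g. *)
Lemma RS_integral_change (f g phi : R -> R) (a b : R) :
  a < b ->
  (forall x, a <= x <= b -> continuity_pt f x) ->
  (forall x, a <= x <= b -> continuity_pt g x) ->
  (forall x y, a <= x -> x <= y -> y <= b -> g x <= g y) ->
  ex_RInt phi (g a) (g b) ->
  (forall x, a <= x <= b -> phi (g x) = f x) ->
  RS_integral f g a b (RInt phi (g a) (g b)).
Proof.
  intros Hab Hf Hg Hmon Hex Hphi eps He.
  assert (Hgab : g a <= g b) by (apply Hmon; lra).
  (* The added 1 covers the case g(a) = g(b) and makes the final inequality strict. *)
  assert (He' : 0 < eps / (g b - g a + 1)) by (apply Rdiv_lt_0_compat; lra).
  destruct (@Heine_cor2 f a b Hf (mkposreal _ He')) as [d Hd].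
  exists d. split; [apply cond_pos|]. intros m p xi Hp Hmesh.
  assert (Hle := tagged_partition_le _ _ _ _ _ Hp).
  assert (Hsub : forall u v, a <= u -> u <= v -> v <= b -> ex_RInt phi (g u) (g v)).
  { intros u v H1 H2 H3.
    assert (A1 : g a <= g u) by (apply Hmon; lra).
    assert (A2 : g u <= g v) by (apply Hmon; lra).
    assert (A3 : g v <= g b) by (apply Hmon; lra).
    apply (@ex_RInt_Chasles_1 R_CompleteNormedModule) with (g b); [lra|].
    apply (@ex_RInt_Chasles_2 R_CompleteNormedModule) with (g a); [lra|easy]. }
  assert (Hb : forall j, (j <= m)%nat ->
    Rabs (rs_sum f g p xi j - RInt phi (g a) (g (p j)))
      <= eps / (g b - g a + 1) * (g (p j) - g a)).
  { induction j as [|j IH]; intros Hj.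
    - destruct Hp as (E0 & _). rewrite E0. simpl. rewrite RInt_point.
      unfold zero; simpl. replace (0 - 0) with 0 by ring. rewrite Rabs_R0. lra.
    - specialize (IH ltac:(lia)).
      assert (H1 := Hle j ltac:(lia)). assert (H2 := Hle (S j) Hj).
      specialize (Hmesh j ltac:(lia)).
      destruct Hp as (_ & _ & Hi). destruct (Hi j) as [H3 H4]; [lia|].
      assert (H5 : g (p j) <= g (p (S j))) by (apply Hmon; lra).
      rewrite <- (RInt_Chasles phi (g a) (g (p j)) (g (p (S j)))) by (apply Hsub; lra).
      unfold plus; simpl.
      set (c := f (xi j)).
      assert (Hdiff : Rabs (RInt (fun v => minus (phi v) c) (g (p j)) (g (p (S j))))
              <= eps / (g b - g a + 1) * Rabs (g (p (S j)) - g (p j))).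
      { apply RInt_Rabs_le.
        - apply @ex_RInt_minus; [apply Hsub; lra|apply ex_RInt_const].
        - rewrite Rmin_left, Rmax_right by lra. intros v Hv.
          destruct (IVT_between g (p j) (p (S j)) v) as [z [Hz Ez]]; try lra.
          { intros; apply Hg; lra. }
          unfold minus, plus, opp; simpl. rewrite <- Ez, Hphi by lra.
          left. apply Hd; try lra. apply Rabs_def1; lra. }
      rewrite (@RInt_minus R_CompleteNormedModule phi (fun _ => c)) in Hdiff;
        [|apply Hsub; lra|apply ex_RInt_const].
      rewrite RInt_const in Hdiff.
      unfold minus, plus, opp, scal in Hdiff; simpl in Hdiff.
      unfold mult in Hdiff; simpl in Hdiff.
      rewrite (Rabs_pos_eq (g _ - g _)) in Hdiff by lra.
      set (A := rs_sum f g p xi j) in *. set (B := RInt phi (g a) (g (p j))) in *.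
      set (C := RInt phi (g (p j)) (g (p (S j)))) in *.
      replace (A + c * (g (p (S j)) - g (p j)) - (B + C))
        with ((A - B) + - (C + - ((g (p (S j)) - g (p j)) * c))) by ring.
      eapply Rle_trans; [apply Rabs_triang|]. rewrite Rabs_Ropp. lra. }
  specialize (Hb m (Nat.le_refl m)).
  destruct Hp as (_ & Em & _). rewrite Em in Hb.
  eapply Rle_lt_trans; [exact Hb|].
  apply Rlt_le_trans with (eps / (g b - g a + 1) * (g b - g a + 1)); [nra|].
  right. field. lra.
Qed.

(** * Integration against dQ through Riemann integrals *)

Definition cont_above (tau : R) (F : R -> R) : Prop :=
  forall x, tau < x -> continuity_pt F x.

Definition mono_above (tau : R) (Q : R -> R) : Prop :=
  forall x y, tau < x -> x <= y -> Q x <= Q y.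

Definition shift_inv (tau : R) (Q : R -> R) (v : R) : R :=
  epsilon (inhabits 0) (fun u => tau < u /\ u + Q u = v).

(* The Stieltjes integral of [F] against [dQ = d(u + Q u) - du]: since [u + Q u] is
   strictly increasing with a 1-Lipschitz inverse, both terms are Riemann integrals. *)
Definition stint (tau : R) (Q F : R -> R) (a b : R) : R :=
  RInt (fun v => F (shift_inv tau Q v)) (a + Q a) (b + Q b) - RInt F a b.

Lemma shift_inv_graph (tau : R) (Q : R -> R) (u : R) :
  mono_above tau Q -> tau < u -> shift_inv tau Q (u + Q u) = u.
Proof.
  intros HQ Hu. unfold shift_inv.
  destruct (epsilon_spec (inhabits 0) (fun w => tau < w /\ w + Q w = u + Q u)) as [H1 H2].
  { now exists u. }
  set (w := epsilon _ _) in *.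
  destruct (Rtotal_order w u) as [H|[H|H]]; [|easy|].
  - assert (Q w <= Q u) by (apply HQ; lra). lra.
  - assert (Q u <= Q w) by (apply HQ; lra). lra.
Qed.

Lemma continuity_pt_shift (tau : R) (Q : R -> R) :
  cont_above tau Q -> cont_above tau (fun u => u + Q u).
Proof.
  intros HQ x Hx. apply continuity_pt_plus; [apply derivable_continuous_pt, derivable_pt_id|].
  now apply HQ.
Qed.

Lemma shift_surj (tau : R) (Q : R -> R) (a b v : R) :
  cont_above tau Q -> tau < a -> a <= b -> a + Q a <= v <= b + Q b ->
  exists u, a <= u <= b /\ u + Q u = v.
Proof.
  intros HQ Ha Hab Hv.
  apply (IVT_between (fun u => u + Q u)); [easy| |easy].
  intros x Hx. apply (continuity_pt_shift tau Q HQ). lra.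
Qed.

Lemma continuity_pt_shift_inv (tau : R) (Q : R -> R) (u : R) :
  mono_above tau Q -> cont_above tau Q -> tau < u ->
  continuity_pt (shift_inv tau Q) (u + Q u).
Proof.
  intros HQ HQc Hu.
  set (a := (tau + u) / 2).
  assert (Ha : tau < a < u) by (unfold a; lra).
  assert (Qa : Q a <= Q u) by (apply HQ; lra).
  assert (Qb : Q u <= Q (u + 1)) by (apply HQ; lra).
  intros eps He.
  (* The bounds u - a and 1 keep v between the images of a and u + 1 under u + Q(u), so that v has a
     preimage; [eps] then suffices by the Lipschitz bound. *)
  exists (Rmin eps (Rmin (u - a) 1)). split.
  { apply Rmin_pos; [easy|apply Rmin_pos; lra]. }
  intros v [_ Hv]. simpl in *. unfold Rdist in *.
  assert (M1 := Rmin_l eps (Rmin (u - a) 1)). assert (M2 := Rmin_r eps (Rmin (u - a) 1)).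
  assert (M3 := Rmin_l (u - a) 1). assert (M4 := Rmin_r (u - a) 1).
  rewrite shift_inv_graph by easy.
  assert (Hv1 := Rabs_def2 _ _ Hv).
  destruct (shift_surj tau Q a (u + 1) v) as [w [Hw Ew]]; try easy; try lra.
  rewrite <- Ew, shift_inv_graph by (easy || lra).
  assert (Rabs (w - u) <= Rabs (v - (u + Q u))); [|lra].
  rewrite <- Ew. destruct (Rle_dec w u) as [H|H].
  - assert (Q w <= Q u) by (apply HQ; lra). rewrite !Rabs_left1; lra.
  - assert (Q u <= Q w) by (apply HQ; lra). rewrite !Rabs_pos_eq; lra.
Qed.

Lemma ex_RInt_above (tau : R) (F : R -> R) (a b : R) :
  cont_above tau F -> tau < a -> tau < b -> ex_RInt F a b.
Proof.
  intros HF Ha Hb. apply (@ex_RInt_continuous R_CompleteNormedModule). intros z Hz.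
  apply continuity_pt_filterlim, HF.
  revert Hz; unfold Rmin; destruct (Rle_dec a b); lra.
Qed.

Lemma ex_RInt_shift (tau : R) (Q F : R -> R) (a b : R) :
  mono_above tau Q -> cont_above tau Q -> cont_above tau F -> tau < a -> tau < b ->
  ex_RInt (fun v => F (shift_inv tau Q v)) (a + Q a) (b + Q b).
Proof.
  intros HQ HQc HF.
  assert (H : forall a b, tau < a -> a <= b ->
     ex_RInt (fun v => F (shift_inv tau Q v)) (a + Q a) (b + Q b)).
  { clear a b. intros a b Ha Hab. assert (Q a <= Q b) by (apply HQ; lra).
    apply (@ex_RInt_continuous R_CompleteNormedModule). rewrite Rmin_left, Rmax_right by lra.
    intros v Hv. destruct (shift_surj tau Q a b v) as [w [Hw <-]]; try easy.
    apply continuity_pt_filterlim.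
    apply (continuity_pt_comp (shift_inv tau Q) F).
    - apply continuity_pt_shift_inv; easy || lra.
    - rewrite shift_inv_graph by (easy || lra). apply HF. lra. }
  intros Ha Hb. destruct (Rle_dec a b); [now apply H|].
  apply ex_RInt_swap, H; lra.
Qed.

Lemma stint_Chasles (tau : R) (Q F : R -> R) (a b c : R) :
  mono_above tau Q -> cont_above tau Q -> cont_above tau F ->
  tau < a -> tau < b -> tau < c ->
  stint tau Q F a c = stint tau Q F a b + stint tau Q F b c.
Proof.
  intros HQ HQc HF Ha Hb Hc. unfold stint.
  rewrite <- (RInt_Chasles F a b c) by (now apply ex_RInt_above with tau).
  rewrite <- (RInt_Chasles (fun v => F (shift_inv tau Q v)) (a + Q a) (b + Q b) (c + Q c))
    by (now apply ex_RInt_shift).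
  unfold plus; simpl. ring.
Qed.

Lemma stint_linear (tau : R) (Q F1 F2 : R -> R) (c a b : R) :
  mono_above tau Q -> cont_above tau Q -> cont_above tau F1 -> cont_above tau F2 ->
  tau < a -> tau < b ->
  stint tau Q (fun u => c * F1 u + F2 u) a b = c * stint tau Q F1 a b + stint tau Q F2 a b.
Proof.
  intros HQ HQc HF1 HF2 Ha Hb. unfold stint.
  assert (H : forall f1 f2 x y, ex_RInt f1 x y -> ex_RInt f2 x y ->
    RInt (fun u => c * f1 u + f2 u) x y = c * RInt f1 x y + RInt f2 x y).
  { intros f1 f2 x y H1 H2.
    rewrite (RInt_plus (fun u => c * f1 u) f2); [|now apply @ex_RInt_scal|easy].
    rewrite (RInt_scal f1) by easy. reflexivity. }
  rewrite (H F1 F2) by (now apply ex_RInt_above with tau).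
  rewrite (H (fun v => F1 (shift_inv tau Q v)) (fun v => F2 (shift_inv tau Q v)))
    by (now apply ex_RInt_shift).
  ring.
Qed.

Lemma stint_ext (tau : R) (Q F1 F2 : R -> R) (a b : R) :
  (forall u, F1 u = F2 u) -> stint tau Q F1 a b = stint tau Q F2 a b.
Proof.
  intros H. unfold stint.
  rewrite (RInt_ext F1 F2) by (intros; apply H).
  rewrite (RInt_ext (fun v => F1 (shift_inv tau Q v)) (fun v => F2 (shift_inv tau Q v)))
    by (intros; apply H).
  reflexivity.
Qed.

(** Writes dg as d(T + g) - dT; the integrand factors through both integrators. With T the time
    change this computes conditional expectations, and with T the identity it shows that [stint] is
    the Stieltjes integral of F against dQ. *)
Lemma RS_integral_stint (tau : R) (Q F g T : R -> R) (s t : R) :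
  mono_above tau Q -> cont_above tau Q -> cont_above tau F -> s < t ->
  (forall y, s <= y <= t -> tau < T y /\ Q (T y) = g y) ->
  (forall y, s <= y <= t -> continuity_pt T y) ->
  (forall y, s <= y <= t -> continuity_pt g y) ->
  (forall x y, s <= x -> x <= y -> y <= t -> T x <= T y) ->
  RS_integral (fun y => F (T y)) g s t (stint tau Q F (T s) (T t)).
Proof.
  intros HQ HQc HF Hst HT HTc Hgc HTm.
  assert (Hgm : forall x y, s <= x -> x <= y -> y <= t -> g x <= g y).
  { intros x y H1 H2 H3. destruct (HT x) as [A1 <-]; [lra|]. destruct (HT y) as [A2 <-]; [lra|].
    apply HQ; [easy|now apply HTm]. }
  destruct (HT s) as [Hs Es]; [lra|]. destruct (HT t) as [Ht Et]; [lra|].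
  assert (HFT : forall y, s <= y <= t -> continuity_pt (fun y => F (T y)) y).
  { intros y Hy. apply (continuity_pt_comp T F); [now apply HTc|apply HF, HT, Hy]. }
  apply RS_integral_ext with (fun y => F (T y)) (fun y => (T y + g y) - T y);
    [intros; ring|].
  unfold stint. rewrite Es, Et.
  apply RS_integral_minus.
  - apply (RS_integral_change (fun y => F (T y)) (fun y => T y + g y)); try easy.
    + intros y Hy. apply continuity_pt_plus; [now apply HTc|now apply Hgc].
    + intros x y H1 H2 H3. specialize (Hgm x y H1 H2 H3). specialize (HTm x y H1 H2 H3). lra.
    + rewrite <- Es, <- Et. now apply ex_RInt_shift.
    + intros y Hy. destruct (HT y Hy) as [H1 <-]. now rewrite shift_inv_graph.
  - apply (RS_integral_change (fun y => F (T y)) T); try easy.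
    now apply ex_RInt_above with tau.
Qed.

Lemma continuity_pt_idR (x : R) : continuity_pt (fun y => y) x.
Proof. apply derivable_continuous_pt, derivable_pt_id. Qed.

(** The two Riemann integrals in [stint] are not small when Q varies little; their cancellation
    becomes visible only on the Stieltjes sums, whose weights add up to Q(b) - Q(a). *)
Lemma stint_bound (tau : R) (Q F : R -> R) (a b K : R) :
  mono_above tau Q -> cont_above tau Q -> cont_above tau F -> tau < a -> tau < b ->
  (forall x, Rmin a b <= x <= Rmax a b -> Rabs (F x) <= K) ->
  Rabs (stint tau Q F a b) <= K * Rabs (Q b - Q a).
Proof.
  intros HQ HQc HF.
  assert (H : forall a b, tau < a -> a < b -> (forall x, a <= x <= b -> Rabs (F x) <= K) ->
     Rabs (stint tau Q F a b) <= K * Rabs (Q b - Q a)).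
  { clear a b. intros a b Ha Hab Hb.
    assert (Q a <= Q b) by (apply HQ; lra). rewrite (Rabs_pos_eq (Q b - Q a)) by lra.
    apply (RS_integral_bound F Q a b); try easy.
    - intros x y H1 H2 H3. apply HQ; lra.
    - apply (RS_integral_stint tau Q F Q (fun y => y)); try easy.
      + intros y Hy. split; [lra|easy].
      + intros y Hy. apply continuity_pt_idR.
      + intros y Hy. apply HQc. lra. }
  intros Ha Hb HK.
  assert (Haa : forall x, tau < x -> stint tau Q F x x = 0).
  { intros x Hx. unfold stint. rewrite !RInt_point. unfold zero; simpl. ring. }
  destruct (Rtotal_order a b) as [L|[E|L]].
  - apply H; try easy. rewrite Rmin_left, Rmax_right in HK by lra. easy.
  - subst b. rewrite (Haa a Ha), (Rminus_diag_eq (Q a) (Q a)), Rabs_R0 by easy. lra.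
  - assert (E := stint_Chasles tau Q F a b a HQ HQc HF Ha Hb Ha).
    rewrite (Haa a Ha) in E.
    replace (stint tau Q F a b) with (- stint tau Q F b a) by lra.
    rewrite Rabs_Ropp, Rabs_minus_sym. apply H; try easy.
    rewrite Rmin_right, Rmax_left in HK by lra. easy.
Qed.

Lemma mono_above_id (tau : R) : mono_above tau (fun u => u).
Proof. now intros x y _ H. Qed.

Lemma cont_above_id (tau : R) : cont_above tau (fun u => u).
Proof. intros x _. apply continuity_pt_idR. Qed.

(** Unfolded, the left side is an integral over [2a, 2b] minus one over [a, b]; it agrees with the
    right side because both are limits of the same Riemann sums. *)
Lemma stint_id (tau : R) (F : R -> R) (a b : R) :
  cont_above tau F -> tau < a -> a < b ->
  stint tau (fun u => u) F a b = RInt F a b.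
Proof.
  intros HF Ha Hab.
  apply (RS_integral_unique F (fun u => u) a b _ _ Hab).
  - apply (RS_integral_stint tau (fun u => u) F (fun u => u) (fun u => u));
      auto using mono_above_id, cont_above_id, continuity_pt_idR.
    intros y Hy. split; [lra|easy].
  - apply (RS_integral_change F (fun u => u)); try easy.
    + intros x Hx. apply HF. lra.
    + intros; apply continuity_pt_idR.
    + apply ex_RInt_above with tau; easy || lra.
Qed.

(** * First-order expansion in the lower endpoint *)

(** Multiplying the expansion by z - d turns a remainder e into (z - d) e + (n + 1) z^n d^2. The
    constant is uniform in z, so the estimate can be integrated with z = Q(u) - Q(x). *)
Lemma pow_shift_expansion (n : nat) (B : R) :
  0 <= B ->
  exists C, 0 <= C /\ forall z d, Rabs z <= B -> Rabs d <= B ->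
    Rabs ((z - d) ^ S n - z ^ S n + INR (S n) * d * z ^ n) <= C * d ^ 2.
Proof.
  intros HB. induction n as [|n [C [HC IH]]].
  - exists 0. split; [lra|]. intros z d _ _.
    replace (_ + _) with 0 by (simpl; ring). rewrite Rabs_R0. lra.
  - exists (2 * B * C + INR (S n) * B ^ n). split.
    { assert (0 <= B ^ n) by now apply pow_le. assert (0 <= INR (S n)) by apply pos_INR. nra. }
    intros z d Hz Hd. specialize (IH z d Hz Hd).
    set (e := (z - d) ^ S n - z ^ S n + INR (S n) * d * z ^ n) in *.
    replace ((z - d) ^ S (S n) - z ^ S (S n) + INR (S (S n)) * d * z ^ S n)
      with ((z - d) * e + INR (S n) * z ^ n * d ^ 2)
      by (unfold e; rewrite (S_INR (S n)); simpl; ring).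
    eapply Rle_trans; [apply Rabs_triang|].
    rewrite !Rabs_mult, <- !RPow_abs, (Rabs_pos_eq (INR (S n))) by apply pos_INR.
    rewrite pow2_abs.
    assert (H1 : Rabs (z - d) <= 2 * B).
    { unfold Rminus. eapply Rle_trans; [apply Rabs_triang|]. rewrite Rabs_Ropp. lra. }
    assert (H2 : Rabs z ^ n <= B ^ n) by (apply pow_incr; split; [apply Rabs_pos|easy]).
    assert (H3 : Rabs (z - d) * Rabs e <= 2 * B * (C * d ^ 2))
      by (apply Rmult_le_compat; auto using Rabs_pos).
    assert (H4 : INR (S n) * (Rabs z ^ n * d ^ 2) <= INR (S n) * (B ^ n * d ^ 2)).
    { apply Rmult_le_compat_l; [apply pos_INR|].
      apply Rmult_le_compat_r; [apply pow2_ge_0|easy]. }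
    lra.
Qed.

Lemma cont_above_mult (tau : R) (F1 F2 : R -> R) :
  cont_above tau F1 -> cont_above tau F2 -> cont_above tau (fun u => F1 u * F2 u).
Proof. intros H1 H2 x Hx. apply (continuity_pt_mult F1 F2); auto. Qed.

Lemma cont_above_const (tau c : R) : cont_above tau (fun _ => c).
Proof. intros x Hx. apply continuity_pt_const. now intros ? ?. Qed.

Lemma cont_above_plus (tau : R) (F1 F2 : R -> R) :
  cont_above tau F1 -> cont_above tau F2 -> cont_above tau (fun u => F1 u + F2 u).
Proof. intros H1 H2 x Hx. apply (continuity_pt_plus F1 F2); auto. Qed.

Lemma cont_above_minus (tau : R) (F1 F2 : R -> R) :
  cont_above tau F1 -> cont_above tau F2 -> cont_above tau (fun u => F1 u - F2 u).
Proof. intros H1 H2 x Hx. apply (continuity_pt_minus F1 F2); auto. Qed.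

Lemma cont_above_pow (tau : R) (F : R -> R) (n : nat) :
  cont_above tau F -> cont_above tau (fun u => F u ^ n).
Proof.
  intros H. induction n as [|n IH]; simpl; [apply cont_above_const|].
  now apply (cont_above_mult tau F).
Qed.

Create HintDb cont.
#[local] Hint Resolve cont_above_mult cont_above_const cont_above_plus cont_above_minus
  cont_above_pow : cont.

(* The case [Q = id] says that the [x]-derivative of [stint (F (u - x)^(j+1))] over [x, y]
   is [-(j+1)] times the same integral with exponent [j]; in general, [Q] need not be
   differentiable and this is the derivative with respect to [Q x]. *)
Lemma stint_pow_expansion (tau : R) (Q F : R -> R) (x y : R) (j : nat) :
  mono_above tau Q -> cont_above tau Q -> cont_above tau F -> tau < x < y ->
  exists C d, 0 <= C /\ 0 < d /\ forall x', Rabs (x' - x) < d ->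
    tau < x' < y /\
    Rabs (stint tau Q (fun u => F u * (Q u - Q x') ^ S j) x' y
          - stint tau Q (fun u => F u * (Q u - Q x) ^ S j) x y
          + INR (S j) * (Q x' - Q x) * stint tau Q (fun u => F u * (Q u - Q x) ^ j) x y)
      <= C * (Q x' - Q x) ^ 2.
Proof.
  intros HQ HQc HF Hx.
  set (a := (tau + x) / 2). set (d := Rmin (x - a) (y - x)).
  assert (Ha : tau < a < x) by (unfold a; lra).
  assert (Hd1 : d <= x - a) by apply Rmin_l. assert (Hd2 : d <= y - x) by apply Rmin_r.
  assert (Hd : 0 < d) by (apply Rmin_pos; lra).
  destruct (continuous_bounded F a y) as [K [HK0 HK]]; [lra|intros; apply HF; lra|].
  set (B := Q y - Q a).
  assert (Qxa : Q a <= Q x) by (apply HQ; lra).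
  assert (Qxy : Q x <= Q y) by (apply HQ; lra).
  assert (HB : 0 <= B) by (unfold B; lra).
  destruct (pow_shift_expansion j B HB) as [C1 [HC1 Hexp]].
  assert (HBj : 0 <= B ^ j) by now apply pow_le.
  assert (HSj : 0 <= INR (S j)) by apply pos_INR.
  exists (K * C1 * B + K * B ^ j + INR (S j) * K * B ^ j), d. split.
  { assert (0 <= K * C1) by now apply Rmult_le_pos.
    assert (0 <= K * B ^ j) by now apply Rmult_le_pos. nra. }
  split; [easy|]. intros x' Hx'. apply Rabs_def2 in Hx'.
  split; [lra|].
  set (D := Q x' - Q x).
  assert (Hrange : forall u, a <= u <= y -> Q a <= Q u <= Q y)
    by (intros u Hu; split; apply HQ; lra).
  assert (HQx' := Hrange x' ltac:(lra)).
  assert (HD : Rabs D <= B) by (unfold D, B in *; apply Rabs_le; lra).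
  assert (HZ : forall u, a <= u <= y -> Rabs (Q u - Q x) <= B).
  { intros u Hu. specialize (Hrange u Hu). unfold B. apply Rabs_le. lra. }
  set (A1 := fun u => F u * (Q u - Q x) ^ S j).
  set (A0 := fun u => F u * (Q u - Q x) ^ j).
  set (E := fun u => F u * (Q u - Q x') ^ S j).
  assert (cA1 : cont_above tau A1) by (unfold A1; auto 6 with cont).
  assert (cA0 : cont_above tau A0) by (unfold A0; auto 6 with cont).
  assert (cE : cont_above tau E) by (unfold E; auto 6 with cont).
  rewrite (stint_Chasles tau Q A1 x x' y) by (easy || lra).
  rewrite (stint_Chasles tau Q A0 x x' y) by (easy || lra).
  (* On the common range [x', y] the three integrands combine into F times the remainder of the
     power expansion for z = Q(u) - Q(x) and d = D. *)
  assert (Esum : stint tau Q (fun u => (-1) * A1 u + (INR (S j) * D * A0 u + E u)) x' y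
    = - stint tau Q A1 x' y + (INR (S j) * D * stint tau Q A0 x' y + stint tau Q E x' y)).
  { rewrite (stint_linear tau Q A1 (fun u => INR (S j) * D * A0 u + E u));
      try (easy || lra); [|auto 6 with cont].
    rewrite (stint_linear tau Q A0 E) by (easy || lra). ring. }
  set (S1 := stint tau Q (fun u => (-1) * A1 u + (INR (S j) * D * A0 u + E u)) x' y) in *.
  assert (HS1 : Rabs S1 <= K * C1 * D ^ 2 * Rabs (Q y - Q x')).
  { apply stint_bound; try (easy || lra); [auto 8 with cont|].
    rewrite Rmin_left, Rmax_right by lra. intros u Hu.
    replace (_ + _) with (F u * ((Q u - Q x - D) ^ S j - (Q u - Q x) ^ S j
       + INR (S j) * D * (Q u - Q x) ^ j)).
    2:{ unfold A1, A0, E. replace (Q u - Q x - D) with (Q u - Q x') by (unfold D; ring). ring. }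
    rewrite Rabs_mult, (Rmult_assoc K C1). apply Rmult_le_compat; try apply Rabs_pos.
    - apply HK; lra.
    - apply Hexp; [apply HZ; lra|easy]. }
  assert (HS2 : Rabs (Q y - Q x') <= B) by (unfold B; apply Rabs_le; lra).
  assert (Hmid : forall u, Rmin x x' <= u <= Rmax x x' -> a <= u <= y /\ Rabs (Q u - Q x) <= Rabs D).
  { intros u. unfold Rmin, Rmax, D. destruct (Rle_dec x x') as [L|L]; intros Hu; split; try lra.
    - assert (Q x <= Q u) by (apply HQ; lra). assert (Q u <= Q x') by (apply HQ; lra).
      rewrite !Rabs_pos_eq; lra.
    - assert (Q x' <= Q u) by (apply HQ; lra). assert (Q u <= Q x) by (apply HQ; lra).
      rewrite !Rabs_left1; lra. }
  (* Between x and x' the integrand [A1] is O(D) thanks to the exponent j + 1, and dQ has mass |D|,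
     so this piece is O(D^2). The integral of [A0] below is only O(D), but it enters multiplied by
     D. *)
  assert (HA1 : Rabs (stint tau Q A1 x x') <= K * (B ^ j * Rabs D) * Rabs D).
  { apply stint_bound; try (easy || lra). intros u Hu. destruct (Hmid u Hu) as [H1 H2].
    unfold A1. rewrite Rabs_mult, <- RPow_abs. apply Rmult_le_compat; try apply Rabs_pos.
    - apply pow_le, Rabs_pos.
    - now apply HK.
    - simpl. rewrite Rmult_comm. apply Rmult_le_compat; auto using Rabs_pos.
      + apply pow_le, Rabs_pos.
      + apply pow_incr. split; [apply Rabs_pos|lra]. }
  assert (HA0 : Rabs (stint tau Q A0 x x') <= K * B ^ j * Rabs D).
  { apply stint_bound; try (easy || lra). intros u Hu. destruct (Hmid u Hu) as [H1 H2].
    unfold A0. rewrite Rabs_mult, <- RPow_abs. apply Rmult_le_compat; try apply Rabs_pos.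
    - apply pow_le, Rabs_pos.
    - now apply HK.
    - apply pow_incr. split; [apply Rabs_pos|lra]. }
  replace (stint tau Q E x' y - (stint tau Q A1 x x' + stint tau Q A1 x' y)
     + INR (S j) * D * (stint tau Q A0 x x' + stint tau Q A0 x' y))
    with (S1 + (- stint tau Q A1 x x' + INR (S j) * D * stint tau Q A0 x x'))
    by (rewrite Esum; ring).
  eapply Rle_trans; [apply Rabs_triang|].
  eapply Rle_trans; [apply Rplus_le_compat_l, Rabs_triang|].
  rewrite Rabs_Ropp, !Rabs_mult, (Rabs_pos_eq (INR (S j))) by easy.
  assert (HDD : Rabs D * Rabs D = D ^ 2) by (rewrite <- Rabs_mult, Rabs_pos_eq; [ring|nra]).
  assert (G1 : K * C1 * D ^ 2 * Rabs (Q y - Q x') <= K * C1 * D ^ 2 * B).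
  { apply Rmult_le_compat_l; [|easy]. apply Rmult_le_pos; [now apply Rmult_le_pos|apply pow2_ge_0]. }
  assert (G2 : INR (S j) * Rabs D * Rabs (stint tau Q A0 x x')
     <= INR (S j) * Rabs D * (K * B ^ j * Rabs D)).
  { apply Rmult_le_compat_l; [|easy]. apply Rmult_le_pos; [easy|apply Rabs_pos]. }
  replace (INR (S j) * Rabs D * (K * B ^ j * Rabs D))
    with (INR (S j) * K * B ^ j * (Rabs D * Rabs D)) in G2 by ring.
  replace (K * (B ^ j * Rabs D) * Rabs D) with (K * B ^ j * (Rabs D * Rabs D)) in HA1 by ring.
  rewrite HDD in *. lra.
Qed.

(** * Derivatives of divided differences *)

Lemma Deriv_eq (f : R -> R) (x l : R) : derivable_pt_lim f x l -> Deriv f x = l.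
Proof.
  intros H. unfold Deriv. apply uniqueness_limite with f x; [|easy].
  apply (epsilon_spec (inhabits 0) (fun l => derivable_pt_lim f x l)). now exists l.
Qed.

Lemma derivable_pt_lim_ext_loc (f g : R -> R) (x l : R) :
  locally x (fun y => f y = g y) -> derivable_pt_lim f x l -> derivable_pt_lim g x l.
Proof.
  intros H Hf. apply is_derive_Reals. apply is_derive_Reals in Hf.
  now apply is_derive_ext_loc with f.
Qed.

Lemma Dn_Deriv (h : R -> R) (p : nat) : Dn p (Deriv h) = Dn (S p) h.
Proof. induction p as [|p IH]; [reflexivity|]. simpl in *. now rewrite IH. Qed.

(** [Deriv] has a known value only where a derivative exists, and that value depends on the function
    near the point. The equality is therefore carried on an open set P, with a candidate for every
    order. *)
Lemma Dn_eq_family (P : R -> Prop) (f : R -> R) (a : nat -> R -> R) (n : nat) :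
  (forall x, P x -> locally x P) -> (forall x, P x -> f x = a O x) ->
  (forall i x, (i < n)%nat -> P x -> derivable_pt_lim (a i) x (a (S i) x)) ->
  forall i x, (i <= n)%nat -> P x -> Dn i f x = a i x.
Proof.
  intros HP H0 HS. induction i as [|i IH]; intros x Hi Hx; simpl; [now apply H0|].
  apply Deriv_eq. apply derivable_pt_lim_ext_loc with (a i); [|apply HS; [lia|easy]].
  eapply filter_imp; [|now apply HP]. intros y Hy. simpl. symmetry. apply IH; [lia|easy].
Qed.

Lemma derivable_pt_lim_affine (p : R -> R) (c e w z l : R) :
  derivable_pt_lim p (c + z * e) l ->
  derivable_pt_lim (fun u => p (c + u * e) * w) z (l * (e * w)).
Proof.
  intros H. apply derivable_pt_lim_ext_loc with (fun u => w * p (c + u * e)).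
  { apply filter_forall. intros u. ring. }
  replace (l * (e * w)) with (w * (l * e)) by ring.
  apply (derivable_pt_lim_scal (fun u => p (c + u * e))).
  apply (derivable_pt_lim_comp (fun u => c + u * e) p); [|exact H].
  apply is_derive_Reals. auto_derive; [easy|ring].
Qed.

Lemma continuity_2d_pt_snd (f : R -> R) (x y : R) :
  continuity_pt f y -> continuity_2d_pt (fun _ v => f v) x y.
Proof.
  intros H. apply (continuity_1d_2d_pt_comp f (fun _ v => v)); [easy|].
  apply continuity_2d_pt_id2.
Qed.

(** The argument x + (y - x) v is affine in either endpoint, so both partial derivatives are
    instances: c = x (1 - v), e = v for y, and c = y v, e = 1 - v for x. *)
Lemma derivable_pt_lim_RInt_affine (tau : R) (p p' c e w : R -> R) (z0 : R) :
  (forall x, tau < x -> derivable_pt_lim p x (p' x)) -> cont_above tau p' ->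
  continuity c -> continuity e -> continuity w ->
  (exists d, 0 < d /\ forall z v, Rabs (z - z0) < d -> 0 <= v <= 1 -> tau < c v + z * e v) ->
  derivable_pt_lim (fun z => RInt (fun v => p (c v + z * e v) * w v) 0 1) z0
    (RInt (fun v => p' (c v + z0 * e v) * (e v * w v)) 0 1).
Proof.
  intros Hp Hp' Hc He Hw [d [Hd Hrange]].
  assert (Hloc : locally z0 (fun z => forall v, 0 <= v <= 1 -> tau < c v + z * e v)).
  { exists (mkposreal d Hd). intros z Hz v Hv. now apply Hrange. }
  assert (HD : forall z v, tau < c v + z * e v ->
     is_derive (fun u => p (c v + u * e v) * w v) z (p' (c v + z * e v) * (e v * w v))).
  { intros z v H. apply is_derive_Reals, derivable_pt_lim_affine. now apply Hp. }
  apply is_derive_Reals.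
  assert (E : RInt (fun v => p' (c v + z0 * e v) * (e v * w v)) 0 1
     = RInt (fun v => Derive (fun u => p (c v + u * e v) * w v) z0) 0 1).
  { apply RInt_ext. rewrite Rmin_left, Rmax_right by lra. intros v Hv. symmetry.
    apply is_derive_unique, HD. apply Hrange; [|lra].
    rewrite Rminus_diag_eq, Rabs_R0; easy. }
  rewrite E.
  apply (is_derive_RInt_param (fun z v => p (c v + z * e v) * w v)).
  - rewrite Rmin_left, Rmax_right by lra.
    eapply filter_imp; [|exact Hloc]. intros z Hz v Hv. eexists. now apply HD, Hz.
  - rewrite Rmin_left, Rmax_right by lra. intros v Hv.
    assert (Hv0 : tau < c v + z0 * e v).
    { apply Hrange; [|easy]. rewrite Rminus_diag_eq, Rabs_R0; easy. }
    assert (Hq : continuity_2d_pt (fun z v => c v + z * e v) z0 v).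
    { apply (continuity_2d_pt_plus (fun _ v => c v) (fun z v => z * e v)).
      - apply continuity_2d_pt_snd, Hc.
      - apply (continuity_2d_pt_mult (fun z _ => z) (fun _ v => e v)).
        + apply continuity_2d_pt_id1.
        + apply continuity_2d_pt_snd, He. }
    apply continuity_2d_pt_ext_loc with
      (fun z v => p' (c v + z * e v) * (e v * w v)).
    + assert (Hpos : 0 < c v + z0 * e v - tau) by lra.
      destruct (Hq (mkposreal _ Hpos)) as [dd Hdd]. exists dd. intros z u H1 H2.
      specialize (Hdd z u H1 H2). simpl in Hdd. apply Rabs_def2 in Hdd.
      symmetry. apply is_derive_unique, HD. lra.
    + apply (continuity_2d_pt_mult (fun z v => p' (c v + z * e v)) (fun _ v => e v * w v)).
      * apply (continuity_1d_2d_pt_comp p' (fun z v => c v + z * e v)); [now apply Hp'|easy].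
      * apply (continuity_2d_pt_snd (fun v => e v * w v)).
        apply (continuity_pt_mult e w); [apply He|apply Hw].
  - eapply filter_imp; [|exact Hloc]. intros z Hz.
    apply (@ex_RInt_continuous R_CompleteNormedModule).
    rewrite Rmin_left, Rmax_right by lra. intros v Hv. apply continuity_pt_filterlim.
    apply (continuity_pt_mult (fun v => p (c v + z * e v)) w); [|apply Hw].
    apply (continuity_pt_comp (fun v => c v + z * e v) p).
    + apply (continuity_pt_plus c (fun v => z * e v)); [apply Hc|].
      apply (continuity_pt_scal e), He.
    + apply derivable_continuous_pt. eexists. apply Hp. now apply Hz.
Qed.

Definition smooth_above (tau : R) (n : nat) (h : R -> R) : Prop :=
  (forall j x, (j < n)%nat -> tau < x -> derivable_pt_lim (Dn j h) x (Dn (S j) h x)) /\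
  cont_above tau (Dn n h).

Lemma smooth_above_cont (tau : R) (n j : nat) (h : R -> R) :
  smooth_above tau n h -> (j <= n)%nat -> cont_above tau (Dn j h).
Proof.
  intros [H1 H2] Hj x Hx. destruct (Nat.eq_dec j n) as [->|N]; [now apply H2|].
  apply derivable_continuous_pt. exists (Dn (S j) h x). apply H1; [lia|easy].
Qed.

(** The (i, j) partial derivative of the integral of h'(x + (y - x) v) over [0, 1]: each
    y-derivative produces a factor v and each x-derivative a factor 1 - v. The formula keeps its
    meaning when h^(i+j+1) is merely continuous. *)
Definition mean_kernel (h : R -> R) (i j : nat) (x y : R) : R :=
  RInt (fun v => Dn (i + j + 1) h (x + (y - x) * v) * (v ^ j * (1 - v) ^ i)) 0 1.

Lemma continuity_pow_fun (f : R -> R) (n : nat) :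
  continuity f -> continuity (fun v => f v ^ n).
Proof.
  intros H. induction n as [|n IH]; simpl.
  - apply continuity_const. now intros ? ?.
  - now apply (continuity_mult f).
Qed.

Lemma continuity_idR : continuity (fun v : R => v).
Proof. intros v. apply continuity_pt_idR. Qed.

Lemma continuity_1minus : continuity (fun v : R => 1 - v).
Proof.
  apply (continuity_minus (fun _ => 1) (fun v => v)); [|apply continuity_idR].
  apply continuity_const. now intros ? ?.
Qed.

Lemma continuity_kernel_weight (i j : nat) : continuity (fun v : R => v ^ j * (1 - v) ^ i).
Proof.
  apply (continuity_mult (fun v => v ^ j) (fun v => (1 - v) ^ i)); apply continuity_pow_fun;
    [apply continuity_idR|apply continuity_1minus].
Qed.

Lemma convex_gt (m a b v : R) : m < a -> m < b -> 0 <= v <= 1 -> m < a * (1 - v) + b * v.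
Proof.
  intros Ha Hb Hv.
  assert (H1 : 0 <= (a - m) * (1 - v)) by (apply Rmult_le_pos; lra).
  assert (H2 : 0 <= (b - m) * v) by (apply Rmult_le_pos; lra).
  destruct (Req_dec v 0) as [->|N]; [lra|].
  assert (0 < (b - m) * v) by (apply Rmult_lt_0_compat; lra). lra.
Qed.

Lemma mean_kernel_derive_y (tau : R) (n : nat) (h : R -> R) (i j : nat) (x y : R) :
  smooth_above tau n h -> (i + j + 2 <= n)%nat -> tau < x -> tau < y ->
  derivable_pt_lim (mean_kernel h i j x) y (mean_kernel h i (S j) x y).
Proof.
  intros Hs Hn Hx Hy.
  assert (E : forall j z, mean_kernel h i j x z = RInt (fun v =>
    Dn (i + j + 1) h (x * (1 - v) + z * v) * (v ^ j * (1 - v) ^ i)) 0 1).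
  { intros j' z. apply RInt_ext. intros v _. do 2 f_equal. ring. }
  apply derivable_pt_lim_ext_loc with (fun z => RInt (fun v =>
    Dn (i + j + 1) h (x * (1 - v) + z * v) * (v ^ j * (1 - v) ^ i)) 0 1).
  { apply filter_forall. intros z. symmetry. apply E. }
  rewrite E.
  rewrite (RInt_ext _ (fun v => Dn (i + S j + 1) h (x * (1 - v) + y * v)
     * (v * (v ^ j * (1 - v) ^ i)))) by (intros v _; simpl; ring).
  apply (derivable_pt_lim_RInt_affine tau _ _ (fun v => x * (1 - v)) (fun v => v)).
  - intros u Hu. replace (i + S j + 1)%nat with (S (i + j + 1)) by lia.
    apply (proj1 Hs); [lia|easy].
  - apply smooth_above_cont with n; [easy|lia].
  - apply (continuity_scal (fun v => 1 - v)), continuity_1minus.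
  - apply continuity_idR.
  - apply continuity_kernel_weight.
  - exists (y - tau). split; [lra|]. intros z v Hz Hv. apply Rabs_def2 in Hz.
    apply convex_gt; lra.
Qed.

Lemma mean_kernel_derive_x (tau : R) (n : nat) (h : R -> R) (i j : nat) (x y : R) :
  smooth_above tau n h -> (i + j + 2 <= n)%nat -> tau < x -> tau < y ->
  derivable_pt_lim (fun x => mean_kernel h i j x y) x (mean_kernel h (S i) j x y).
Proof.
  intros Hs Hn Hx Hy.
  assert (E : forall i z, mean_kernel h i j z y = RInt (fun v =>
    Dn (i + j + 1) h (y * v + z * (1 - v)) * (v ^ j * (1 - v) ^ i)) 0 1).
  { intros i' z. apply RInt_ext. intros v _. do 2 f_equal. ring. }
  apply derivable_pt_lim_ext_loc with (fun z => RInt (fun v =>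
    Dn (i + j + 1) h (y * v + z * (1 - v)) * (v ^ j * (1 - v) ^ i)) 0 1).
  { apply filter_forall. intros z. symmetry. apply E. }
  rewrite E.
  rewrite (RInt_ext _ (fun v => Dn (S i + j + 1) h (y * v + x * (1 - v))
     * ((1 - v) * (v ^ j * (1 - v) ^ i)))) by (intros v _; simpl; ring).
  apply (derivable_pt_lim_RInt_affine tau _ _ (fun v => y * v) (fun v => 1 - v)).
  - intros u Hu. apply (proj1 Hs); [lia|easy].
  - apply smooth_above_cont with n; [easy|lia].
  - apply (continuity_scal (fun v => v)), continuity_idR.
  - apply continuity_1minus.
  - apply continuity_kernel_weight.
  - exists (x - tau). split; [lra|]. intros z v Hz Hv. apply Rabs_def2 in Hz.
    rewrite Rplus_comm. apply convex_gt; lra.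
Qed.

Lemma M_mean_kernel (tau : R) (n : nat) (h : R -> R) (x y : R) :
  smooth_above tau n h -> (1 <= n)%nat -> tau < x -> x < y ->
  M h x y = mean_kernel h 0 0 x y.
Proof.
  intros Hs Hn Hx Hxy. unfold mean_kernel, M. symmetry. apply is_RInt_unique.
  replace ((h y - h x) / (y - x)) with
    (minus (h (x + 1 * (y - x)) * / (y - x)) (h (x + 0 * (y - x)) * / (y - x))).
  2:{ replace (x + 1 * (y - x)) with y by ring. replace (x + 0 * (y - x)) with x by ring.
      unfold minus, plus, opp; simpl. field. lra. }
  assert (Hr : forall v, 0 <= v <= 1 -> tau < x + (y - x) * v) by (intros; nra).
  apply (is_RInt_derive (fun v => h (x + v * (y - x)) * / (y - x))).
  - rewrite Rmin_left, Rmax_right by lra. intros v Hv. apply is_derive_Reals.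
    replace (_ * _) with (Dn 1 h (x + v * (y - x)) * ((y - x) * / (y - x))).
    2:{ simpl. rewrite (Rmult_comm v). field. lra. }
    apply derivable_pt_lim_affine. apply (proj1 Hs 0%nat); [lia|].
    rewrite Rmult_comm. now apply Hr.
  - rewrite Rmin_left, Rmax_right by lra. intros v Hv. apply continuity_pt_filterlim.
    apply (continuity_pt_mult (fun v => Dn 1 h (x + (y - x) * v)) (fun v => v ^ 0 * (1 - v) ^ 0));
      [|apply (continuity_kernel_weight 0 0)].
    apply (continuity_pt_comp (fun v => x + (y - x) * v) (Dn 1 h)).
    + apply (continuity_pt_plus (fun _ => x) (fun v => (y - x) * v)).
      * apply continuity_pt_const. now intros ? ?.
      * apply (continuity_pt_scal (fun v => v)), continuity_pt_idR.
    + now apply (smooth_above_cont tau n 1 h Hs Hn), Hr.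
Qed.

Lemma locally_open_interval (a b x : R) : a < x < b -> locally x (fun y => a < y < b).
Proof. intros H. apply (locally_interval _ x a b); simpl; try easy. Qed.

Lemma Dxy_M_mean_kernel (tau : R) (n : nat) (h : R -> R) (i j : nat) (x y : R) :
  smooth_above tau n h -> (i + j + 1 <= n)%nat -> tau < x -> x < y ->
  Dxy i j (M h) x y = mean_kernel h i j x y.
Proof.
  intros Hs Hn Hx Hxy. unfold Dxy.
  apply (Dn_eq_family (fun x => tau < x < y) _ (fun i x => mean_kernel h i j x y) i); try easy.
  - intros z Hz. now apply locally_open_interval.
  - intros z Hz.
    apply (Dn_eq_family (fun y => z < y) _ (fun j => mean_kernel h 0 j z) j); try lia; try lra.
    + intros u Hu. eapply filter_imp; [|apply (locally_open_interval z (u + 1)); lra].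
      intros; simpl in *; lra.
    + intros u Hu. apply M_mean_kernel with tau n; easy || lia || lra.
    + intros l u Hl Hu. apply mean_kernel_derive_y with tau n; easy || lia || lra.
  - intros l z Hl Hz. apply mean_kernel_derive_x with tau n; easy || lia || lra.
Qed.

(** The substitution u = x + (y - x) v turns the weight into the conditional density for R = id, up
    to its factorial constant. *)
Lemma mean_kernel_RInt (tau : R) (n : nat) (h : R -> R) (i j : nat) (x y : R) :
  smooth_above tau n h -> (i + j + 1 <= n)%nat -> tau < x -> x < y ->
  mean_kernel h i j x y = RInt (fun u => Dn (i + j + 1) h u *
     (((u - x) / (y - x)) ^ j * ((y - u) / (y - x)) ^ i / (y - x))) x y.
Proof.
  intros Hs Hn Hx Hxy.
  set (f := fun u => Dn (i + j + 1) h u *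
     (((u - x) / (y - x)) ^ j * ((y - u) / (y - x)) ^ i / (y - x))).
  assert (E := @RInt_comp_lin R_CompleteNormedModule f (y - x) x 0 1).
  replace ((y - x) * 0 + x) with x in E by ring. replace ((y - x) * 1 + x) with y in E by ring.
  rewrite <- E.
  - apply RInt_ext. intros v _. unfold f, scal; simpl; unfold mult; simpl.
    replace (((y - x) * v + x - x) / (y - x)) with v by (field; lra).
    replace ((y - ((y - x) * v + x)) / (y - x)) with (1 - v) by (field; lra).
    replace (x + (y - x) * v) with ((y - x) * v + x) by ring. field. lra.
  - apply ex_RInt_above with tau; try lra. unfold f, Rdiv.
    assert (H := smooth_above_cont tau n (i + j + 1) h Hs Hn).
    auto 15 using cont_above_id with cont.
Qed.

(** * Differentiability of the integrator *)

Lemma is_lim_finite_eps (f : R -> R) (x l : R) :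
  is_lim f x l <->
  forall eps, 0 < eps -> exists d, 0 < d /\
    forall x', x' <> x -> Rabs (x' - x) < d -> Rabs (f x' - l) < eps.
Proof.
  rewrite <- is_lim_spec. split.
  - intros H eps He. destruct (H (mkposreal eps He)) as [d Hd].
    exists d. split; [apply cond_pos|]. intros x' N Hx'. now apply (Hd x').
  - intros H eps. destruct (H eps (cond_pos eps)) as [d [Hd Hx]].
    exists (mkposreal d Hd). intros x' B N. now apply Hx.
Qed.

Lemma derivable_pt_lim_slope (f : R -> R) (x l : R) :
  derivable_pt_lim f x l <-> is_lim (fun x' => (f x' - f x) / (x' - x)) x l.
Proof.
  rewrite is_lim_finite_eps. split.
  - intros H eps He. destruct (H eps He) as [d Hd]. exists d. split; [apply cond_pos|].
    intros x' N B. specialize (Hd (x' - x)). replace (x + (x' - x)) with x' in Hd by ring.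
    apply Hd; [lra|easy].
  - intros H eps He. destruct (H eps He) as [d [Hd Hx]]. exists (mkposreal d Hd).
    intros u N B. specialize (Hx (x + u)). replace (x + u - x) with u in Hx by ring.
    apply Hx; [lra|easy].
Qed.

Lemma is_lim_quadratic_remainder (Q E : R -> R) (x C d : R) :
  continuity_pt Q x -> 0 < d ->
  (forall x', Rabs (x' - x) < d -> Rabs (E x') <= C * (Q x' - Q x) ^ 2) ->
  is_lim (fun x' => E x' / (Q x' - Q x)) x 0.
Proof.
  intros HQ Hd HE. apply is_lim_finite_eps. intros eps He.
  assert (HC : 0 < eps / (Rabs C + 1)).
  { apply Rdiv_lt_0_compat; [easy|]. assert (0 <= Rabs C) by apply Rabs_pos. lra. }
  destruct (HQ _ HC) as [d' [Hd' H]]. exists (Rmin d d'). split; [now apply Rmin_pos|].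
  intros x' N Hx'.
  assert (B1 : Rabs (x' - x) < d) by (eapply Rlt_le_trans; [exact Hx'|apply Rmin_l]).
  assert (B2 : Rabs (x' - x) < d') by (eapply Rlt_le_trans; [exact Hx'|apply Rmin_r]).
  specialize (HE x' B1).
  assert (HD : Rabs (Q x' - Q x) < eps / (Rabs C + 1)).
  { apply (H x'). split; [split; [easy|now apply not_eq_sym]|exact B2]. }
  set (D := Q x' - Q x) in *. rewrite Rminus_0_r.
  (* Where Q(x') = Q(x) the quotient is 0 by the convention on division, which agrees with the
     claimed limit. *)
  destruct (Req_dec D 0) as [Z|NZ].
  - rewrite Z in HE |- *. unfold Rdiv. rewrite Rinv_0, Rmult_0_r, Rabs_R0. easy.
  - assert (0 < Rabs D) by now apply Rabs_pos_lt.
    unfold Rdiv. rewrite Rabs_mult, Rabs_inv.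
    apply Rmult_lt_reg_r with (Rabs D); [easy|]. rewrite Rmult_assoc, Rinv_l, Rmult_1_r by lra.
    assert (HDD : D ^ 2 = Rabs D * Rabs D) by (rewrite <- Rabs_mult, Rabs_pos_eq; [ring|nra]).
    rewrite HDD in HE.
    assert (HDc : Rabs D * (Rabs C + 1) < eps).
    { apply Rmult_lt_compat_r with (r := Rabs C + 1) in HD;
        [|assert (0 <= Rabs C) by apply Rabs_pos; lra].
      unfold Rdiv in HD. rewrite Rmult_assoc, Rinv_l in HD; [lra|].
      assert (0 <= Rabs C) by apply Rabs_pos; lra. }
    assert (C <= Rabs C) by apply Rle_abs. nra.
Qed.

(* With [Delta = Q x' - Q x] and [D = Q y - Q x], the hypotheses amount to
   [Delta * (D^K (y - x) md + o(1)) = (x' - x) * (D - Delta)^(K+1) * (md + o(1))]. *)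
Lemma derivable_of_balance (Q J m : R -> R) (x y m1 md C d : R) (j K : nat) :
  continuity_pt Q x -> x < y -> Q x < Q y -> md <> 0 -> 0 < d ->
  derivable_pt_lim m x md ->
  (y - x) * md = INR (S K) * m x - INR (S j) * m1 ->
  (forall x', Rabs (x' - x) < d ->
     J x' = (Q y - Q x') ^ S K * m x' /\
     Rabs (J x' - J x + INR (S j) * (Q x' - Q x) * ((Q y - Q x) ^ K * m1))
       <= C * (Q x' - Q x) ^ 2) ->
  derivable_pt_lim Q x ((Q y - Q x) / (y - x)).
Proof.
  intros HQ Hxy HQxy Hmd Hd Hm Hode HJ.
  set (D := Q y - Q x) in *. assert (HD : 0 < D) by (unfold D; lra).
  assert (HJx : J x = D ^ S K * m x).
  { apply HJ. rewrite Rminus_diag_eq, Rabs_R0; easy. }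
  destruct (pow_shift_expansion K D) as [C1 [HC1 Hexp]]; [lra|].
  (* The expansion error of J minus m(x) times that of the power (D - Delta)^(K+1); both are
     O(Delta^2). *)
  set (E := fun x' => J x' - J x + INR (S j) * (Q x' - Q x) * (D ^ K * m1)
    - m x * ((D - (Q x' - Q x)) ^ S K - D ^ S K + INR (S K) * (Q x' - Q x) * D ^ K)).
  destruct (HQ D HD) as [d1 [Hd1 HQ1]].
  assert (HE : is_lim (fun x' => E x' / (Q x' - Q x)) x 0).
  { apply is_lim_quadratic_remainder with (C + Rabs (m x) * C1) (Rmin d d1); [easy|now apply Rmin_pos|].
    intros x' Hx'.
    assert (B1 : Rabs (x' - x) < d) by (eapply Rlt_le_trans; [exact Hx'|apply Rmin_l]).
    assert (B2 : Rabs (x' - x) < d1) by (eapply Rlt_le_trans; [exact Hx'|apply Rmin_r]).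
    assert (HDl : Rabs (Q x' - Q x) <= D).
    { destruct (Req_dec x' x) as [->|N].
      - rewrite Rminus_diag_eq, Rabs_R0; [lra|easy].
      - left. apply (HQ1 x'). split; [split; [easy|now apply not_eq_sym]|exact B2]. }
    unfold E. eapply Rle_trans; [apply Rabs_triang|]. rewrite Rabs_Ropp, Rabs_mult.
    destruct (HJ x' B1) as [_ H1].
    assert (H2 := Hexp D (Q x' - Q x)). rewrite (Rabs_pos_eq D) in H2 by lra.
    specialize (H2 (Rle_refl D) HDl).
    apply Rmult_le_compat_l with (r := Rabs (m x)) in H2; [|apply Rabs_pos]. lra. }
  apply derivable_pt_lim_slope in Hm. apply derivable_pt_lim_slope.
  set (q := fun x' => (m x' - m x) / (x' - x)) in *.
  (* The first-order coefficient of Delta in the balance: by [Hode] it equals D^K ((K + 1) m(x) - (j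
     + 1) m1). *)
  set (A := (y - x) * md * D ^ K).
  assert (HDK : 0 < D ^ K) by now apply pow_lt.
  assert (HA : A <> 0).
  { unfold A. repeat apply Rmult_integral_contrapositive_currified; lra. }
  assert (Hden : is_lim (fun x' => A + E x' / (Q x' - Q x)) x A).
  { replace (Finite A) with (Finite (A + 0)) by (f_equal; ring).
    apply is_lim_plus'; [apply is_lim_const|exact HE]. }
  assert (Hpow : is_lim (fun x' => (Q y - Q x') ^ S K) x (D ^ S K)).
  { apply (is_lim_continuity (fun x' => (Q y - Q x') ^ S K) x).
    apply (continuity_pt_comp (fun x' => Q y - Q x') (fun u => u ^ S K)).
    - apply (continuity_pt_minus (fun _ => Q y) Q); [|easy].
      apply continuity_pt_const. now intros ? ?.
    - apply derivable_continuous_pt, derivable_pt_pow. }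
  assert (Hk : is_lim (fun x' => (Q y - Q x') ^ S K * q x' / (A + E x' / (Q x' - Q x))) x
     (D / (y - x))).
  { replace (Finite (D / (y - x))) with (Rbar_div (Finite (D ^ S K * md)) (Finite A)).
    - apply is_lim_div; [|exact Hden| |easy].
      + apply (is_lim_mult (fun x' => (Q y - Q x') ^ S K) q x (D ^ S K) md); easy.
      + intros Z. apply HA. now inversion Z.
    - unfold Rbar_div; simpl. f_equal. unfold A. field.
      repeat split; lra. }
  revert Hk. apply is_lim_ext_loc.
  apply is_lim_finite_eps with (eps := Rabs A) in Hden; [|now apply Rabs_pos_lt].
  destruct Hden as [d2 [Hd2 Hden]].
  assert (Hdm : 0 < Rmin d d2) by now apply Rmin_pos.
  exists (mkposreal _ Hdm). intros x' B N. change (Rabs (x' - x) < Rmin d d2) in B.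
  assert (B1 : Rabs (x' - x) < d) by (eapply Rlt_le_trans; [exact B|apply Rmin_l]).
  assert (B2 : Rabs (x' - x) < d2) by (eapply Rlt_le_trans; [exact B|apply Rmin_r]).
  specialize (Hden x' N B2).
  set (e := E x' / (Q x' - Q x)) in *.
  assert (Hne : A + e <> 0).
  { intros Z. replace (A + e - A) with (- A) in Hden by lra.
    rewrite Rabs_Ropp in Hden. lra. }
  destruct (HJ x' B1) as [HJ' HJ2].
  (* If Delta = 0, then e = 0 by default, and E(x') = 0 has to be shown: the quadratic bound forces
     J(x') = J(x). *)
  assert (Ee : (Q x' - Q x) * e = E x').
  { unfold e. destruct (Req_dec (Q x' - Q x) 0) as [Z|NZ]; [|field; easy].
    rewrite Z in HJ2 |- *. rewrite Rmult_0_l. unfold E. rewrite Z.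
    assert (Z2 : J x' - J x = 0).
    { assert (H0 : Rabs (J x' - J x + INR (S j) * 0 * (D ^ K * m1)) <= 0) by lra.
      replace (_ + _) with (J x' - J x) in H0 by ring.
      apply Rcomplements.Rabs_eq_0. assert (0 <= Rabs (J x' - J x)) by apply Rabs_pos. lra. }
    rewrite Z2, Rminus_0_r. ring. }
  assert (Eq : (x' - x) * q x' = m x' - m x) by (unfold q; field; lra).
  (* An exact identity: the terms linear in Delta cancel by [Hode], and (Q(y) - Q(x'))^(K+1) (m(x')
     - m(x)) remains. As A + e is nonzero near x, it can be solved for the difference quotient of Q,
     with limit D^(K+1) md / A = D / (y - x). *)
  assert (Main : (Q x' - Q x) * (A + e) = (x' - x) * ((Q y - Q x') ^ S K * q x')).
  { rewrite Rmult_plus_distr_l, Ee. unfold E, A.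
    replace ((x' - x) * ((Q y - Q x') ^ S K * q x'))
      with ((Q y - Q x') ^ S K * ((x' - x) * q x')) by ring.
    rewrite Eq, HJ', HJx, Hode. replace (D - (Q x' - Q x)) with (Q y - Q x') by (unfold D; ring).
    ring. }
  apply Rmult_eq_reg_r with ((A + e) * (x' - x)).
  - unfold Rdiv.
    replace ((Q y - Q x') ^ S K * q x' * / (A + e) * ((A + e) * (x' - x)))
      with ((x' - x) * ((Q y - Q x') ^ S K * q x')) by (field; easy).
    rewrite <- Main. field. lra.
  - apply Rmult_integral_contrapositive_currified; lra.
Qed.

(* From the secant equation to a linear integrator *)
#[local] Hint Resolve cont_above_id mono_above_id : cont.

(** By the quotient rule, (Q(y) - Q(z)) / (y - z) has derivative 0 in z near tau, hence is a
    constant c there. So Q(z) - c (z - tau) equals Q(y) - c (y - tau) for all z near tau, and the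
    limit at tau makes this value 0. *)
Lemma linear_of_local_secant (tau : R) (Q : R -> R) :
  right_lim Q tau 0 ->
  (forall y, tau < y -> exists d, 0 < d /\ forall x, tau < x < tau + d -> x < y ->
     derivable_pt_lim Q x ((Q y - Q x) / (y - x))) ->
  exists c, forall u, tau < u -> Q u = c * (u - tau).
Proof.
  intros Hlim Hsec.
  assert (Hloc : forall y, tau < y -> exists c d, 0 < d /\ Q y = c * (y - tau) /\
     forall x, tau < x < tau + d -> Q x = c * (x - tau)).
  { intros y Hy. destruct (Hsec y Hy) as [d0 [Hd0 H]].
    set (d := Rmin d0 (y - tau)).
    assert (Hd1 : d <= d0) by apply Rmin_l. assert (Hd2 : d <= y - tau) by apply Rmin_r.
    assert (Hd : 0 < d) by (apply Rmin_pos; lra).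
    assert (Hder : forall x, tau < x < tau + d ->
       is_derive (fun z => (Q y - Q z) / (y - z)) x 0).
    { intros x Hx. specialize (H x ltac:(lra) ltac:(lra)). apply is_derive_Reals in H.
      set (l := (Q y - Q x) / (y - x)) in *.
      evar_last.
      - apply (is_derive_div (fun z => Q y - Q z) (fun z => y - z) x (0 - l) (0 - 1)); [| |lra].
        + apply (is_derive_minus (fun _ => Q y) Q x 0 l); [apply is_derive_Reals, derivable_pt_lim_const|exact H].
        + apply (is_derive_minus (fun _ => y) (fun z => z) x 0 1);
            apply is_derive_Reals; [apply derivable_pt_lim_const|apply derivable_pt_lim_id].
      - unfold l. field. lra. }
    set (x0 := tau + d / 2). set (c := (Q y - Q x0) / (y - x0)).
    assert (Hc : forall x, tau < x < tau + d -> Q y - Q x = c * (y - x)).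
    { intros x Hx.
      destruct (MVT_gen (fun z => (Q y - Q z) / (y - z)) x0 x (fun _ => 0)) as [w [_ Hw]].
      - intros z Hz. apply Hder. revert Hz. unfold Rmin, Rmax, x0.
        destruct (Rle_dec (tau + d / 2) x); lra.
      - intros z Hz. apply derivable_continuous_pt. exists 0. apply is_derive_Reals, Hder.
        revert Hz. unfold Rmin, Rmax, x0. destruct (Rle_dec (tau + d / 2) x); lra.
      - rewrite Rmult_0_l in Hw. fold c in Hw.
        replace (Q y - Q x) with ((Q y - Q x) / (y - x) * (y - x)) by (field; lra).
        f_equal. lra. }
    assert (Hdiff : forall x, tau < x < tau + d -> Q y - c * (y - tau) = Q x - c * (x - tau)).
    { intros x Hx. specialize (Hc x Hx). lra. }
    assert (Ey : Q y - c * (y - tau) = 0).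
    { destruct (Req_dec (Q y - c * (y - tau)) 0) as [E|NE]; [easy|exfalso].
      set (e := Rabs (Q y - c * (y - tau))).
      assert (He : 0 < e) by now apply Rabs_pos_lt.
      destruct (Hlim (e / 2)) as [d' [Hd' Hx']]; [lra|].
      assert (Hcp : 0 <= Rabs c) by apply Rabs_pos.
      set (e2 := e / 2 / (Rabs c + 1)).
      assert (He2 : 0 < e2) by (apply Rdiv_lt_0_compat; lra).
      assert (Hq : e2 * (Rabs c + 1) = e / 2) by (unfold e2; field; lra).
      set (dm := Rmin d (Rmin d' e2)).
      assert (Hm : 0 < dm) by (repeat apply Rmin_pos; lra).
      assert (Hm1 : dm <= d) by apply Rmin_l.
      assert (Hm2 : dm <= Rmin d' e2) by apply Rmin_r.
      assert (Hm3 : Rmin d' e2 <= d') by apply Rmin_l.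
      assert (Hm4 : Rmin d' e2 <= e2) by apply Rmin_r.
      specialize (Hx' (tau + dm / 2) ltac:(lra)). rewrite Rminus_0_r in Hx'.
      assert (Hb : e <= Rabs (Q (tau + dm / 2)) + Rabs (c * (dm / 2))).
      { unfold e. rewrite (Hdiff (tau + dm / 2)) by lra.
        replace (tau + dm / 2 - tau) with (dm / 2) by ring.
        eapply Rle_trans; [apply Rabs_triang|]. rewrite Rabs_Ropp. lra. }
      rewrite Rabs_mult, (Rabs_pos_eq (dm / 2)) in Hb by lra.
      assert (Rabs c * (dm / 2) <= (Rabs c + 1) * e2) by (apply Rmult_le_compat; lra).
      lra. }
    exists c, d. split; [easy|]. split; [lra|]. intros x Hx. specialize (Hdiff x Hx). lra. }
  (* The slope so far depends on y, but each of these lines agrees with Q on a right neighbourhood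
     of tau; comparison with the line for tau + 1 there makes all slopes equal. *)
  destruct (Hloc (tau + 1)) as (c & d & Hd & _ & Hc); [lra|].
  exists c. intros u Hu. destruct (Hloc u Hu) as (c' & d' & Hd' & -> & Hc'). f_equal.
  set (dm := Rmin d d'). assert (Hm : 0 < dm) by now apply Rmin_pos.
  assert (Hm1 : dm <= d) by apply Rmin_l. assert (Hm2 : dm <= d') by apply Rmin_r.
  specialize (Hc (tau + dm / 2) ltac:(lra)). specialize (Hc' (tau + dm / 2) ltac:(lra)).
  rewrite Hc in Hc'. apply Rmult_eq_reg_r in Hc'; [now symmetry|lra].
Qed.

(** Gives the kernel the shape N_j / (y - x)^(i+j+1) for Q = id, so that one expansion lemma handles
    both the kernels and the integrals against dQ. *)
Lemma mean_kernel_stint (tau : R) (n : nat) (h : R -> R) (i j : nat) (x y : R) :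
  smooth_above tau n h -> (i + j + 1 <= n)%nat -> tau < x -> x < y ->
  mean_kernel h i j x y =
    stint tau (fun u => u) (fun u => Dn (i + j + 1) h u * (y - u) ^ i * (u - x) ^ j) x y
      / (y - x) ^ S (i + j).
Proof.
  intros Hs Hn Hx Hxy.
  assert (H := smooth_above_cont tau n (i + j + 1) h Hs Hn).
  set (f := fun u => Dn (i + j + 1) h u * (y - u) ^ i * (u - x) ^ j).
  assert (Hf : cont_above tau f) by (unfold f; auto 15 with cont).
  rewrite stint_id, (mean_kernel_RInt tau n) by easy.
  rewrite (RInt_ext _ (fun u => scal (/ (y - x) ^ S (i + j)) (f u))).
  - rewrite (@RInt_scal R_CompleteNormedModule) by (apply ex_RInt_above with tau; easy || lra).
    unfold scal; simpl; unfold mult; simpl. unfold Rdiv. ring.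
  - intros u _. unfold f, scal; simpl; unfold mult; simpl.
    rewrite pow_add. unfold Rdiv. rewrite !Rpow_mult_distr, !pow_inv. field. split; [|split]; try lra.
    all: apply pow_nonzero; lra.
Qed.

(** The kernel already uses the last available derivative of h, so [mean_kernel_derive_x] does not
    apply. Instead m = J_(j+1) / (y - x)^(i+j+2) with J_(j+1)' = -(j + 1) J_j, by the expansion for
    Q = id, and the quotient rule gives the relation. *)
Lemma mean_kernel_derive_secant (tau : R) (h : R -> R) (i j : nat) (x y : R) :
  smooth_above tau (i + S j + 1) h -> tau < x < y ->
  exists md, derivable_pt_lim (fun x => mean_kernel h i (S j) x y) x md /\
    (y - x) * md = INR (S (i + S j)) * mean_kernel h i (S j) x y
                   - INR (S j) * mean_kernel (Deriv h) i j x y.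
Proof.
  intros Hs Hx.
  assert (Hs' : smooth_above tau (i + j + 1) (Deriv h)).
  { destruct Hs as [H1 H2]. split.
    - intros l z Hl Hz. rewrite !Dn_Deriv. apply H1; [lia|easy].
    - rewrite Dn_Deriv. replace (S (i + j + 1)) with (i + S j + 1)%nat by lia. easy. }
  assert (Hg := smooth_above_cont tau _ _ h Hs (Nat.le_refl _)).
  set (F := fun u => Dn (i + S j + 1) h u * (y - u) ^ i).
  assert (HF : cont_above tau F) by (unfold F; auto 15 with cont).
  set (J := fun l z => stint tau (fun u => u) (fun u => F u * (u - z) ^ l) z y).
  assert (Em : forall z, tau < z < y -> mean_kernel h i (S j) z y = J (S j) z / (y - z) ^ S (i + S j)).
  { intros z Hz. rewrite (mean_kernel_stint tau (i + S j + 1)) by (easy || lia || lra). easy. }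
  assert (Em1 : mean_kernel (Deriv h) i j x y = J j x / (y - x) ^ (i + S j)).
  { rewrite (mean_kernel_stint tau (i + j + 1)) by (easy || lia || lra).
    rewrite Dn_Deriv.
    replace (S (i + j + 1)) with (i + S j + 1)%nat by lia.
    replace (S (i + j)) with (i + S j)%nat by lia. easy. }
  assert (HJ : derivable_pt_lim (J (S j)) x (- (INR (S j) * J j x))).
  { destruct (stint_pow_expansion tau (fun u => u) F x y j) as (C & d & HC & Hd & H);
      auto with cont.
    apply derivable_pt_lim_slope.
    assert (HE : is_lim (fun x' => (J (S j) x' - J (S j) x + INR (S j) * (x' - x) * J j x) / (x' - x)) x 0).
    { apply (is_lim_quadratic_remainder (fun u => u) _ x C d); [apply continuity_pt_idR|easy|].
      intros x' Hx'. now apply H. }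
    replace (Finite (- (INR (S j) * J j x))) with (Finite (0 + - (INR (S j) * J j x)))
      by (f_equal; ring).
    apply is_lim_ext_loc with (fun x' => (J (S j) x' - J (S j) x + INR (S j) * (x' - x) * J j x) / (x' - x)
       + - (INR (S j) * J j x)).
    - exists (mkposreal _ Hd). intros x' _ N. field. lra.
    - apply is_lim_plus'; [exact HE|apply is_lim_const]. }
  assert (Hpw : derivable_pt_lim (fun z => (y - z) ^ S (i + S j)) x
            (- (INR (S (i + S j)) * (y - x) ^ (i + S j)))).
  { apply is_derive_Reals. evar_last.
    - apply (is_derive_pow (fun z => y - z) (S (i + S j)) x (-1)). auto_derive; [easy|ring].
    - rewrite Nat.pred_succ. ring. }
  assert (Hpx : (y - x) ^ (i + S j) <> 0) by (apply pow_nonzero; lra).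
  eexists. split.
  - apply derivable_pt_lim_ext_loc with (fun z => J (S j) z / (y - z) ^ S (i + S j)).
    + eapply filter_imp; [|apply (locally_open_interval tau y); easy].
      intros z Hz. symmetry. now apply Em.
    + apply is_derive_Reals. apply is_derive_div; try (apply is_derive_Reals; eassumption).
      apply pow_nonzero; lra.
  - rewrite (Em x Hx), Em1. set (P := (y - x) ^ (i + S j)) in *.
    change ((y - x) ^ S (i + S j)) with ((y - x) * P). field. split; [easy|lra].
Qed.

(** The clause for Q(x) = Q(y) records what the identities say on a plateau, where the two equations
    cleared of denominators carry no information about the kernels. *)
Lemma derivable_of_stint_identities (tau : R) (Q h : R -> R) (i j : nat) (y : R) :
  mono_above tau Q -> cont_above tau Q -> smooth_above tau (i + S j + 1) h ->
  (forall x, tau < x < y ->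
     (Q x = Q y -> mean_kernel h i (S j) x y = 0 /\ mean_kernel (Deriv h) i j x y = 0) /\
     stint tau Q (fun u => Dn (i + S j + 1) h u * (Q y - Q u) ^ i * (Q u - Q x) ^ S j) x y
       = (Q y - Q x) ^ S (i + S j) * mean_kernel h i (S j) x y /\
     stint tau Q (fun u => Dn (i + S j + 1) h u * (Q y - Q u) ^ i * (Q u - Q x) ^ j) x y
       = (Q y - Q x) ^ (i + S j) * mean_kernel (Deriv h) i j x y) ->
  forall x, tau < x < y -> Deriv (fun x => mean_kernel h i (S j) x y) x <> 0 ->
  derivable_pt_lim Q x ((Q y - Q x) / (y - x)).
Proof.
  intros HQ HQc Hs Hid x Hx Hne.
  assert (Hg := smooth_above_cont tau _ _ h Hs (Nat.le_refl _)).
  destruct (mean_kernel_derive_secant tau h i j x y Hs Hx) as [md [Hmd Hode]].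
  rewrite (Deriv_eq _ _ _ Hmd) in Hne.
  set (F := fun u => Dn (i + S j + 1) h u * (Q y - Q u) ^ i).
  assert (HF : cont_above tau F) by (unfold F; auto 15 with cont).
  destruct (stint_pow_expansion tau Q F x y j HQ HQc HF Hx) as (C & d & HC & Hd & Hexp).
  destruct (Hid x Hx) as (Hz & _ & H2).
  assert (Qxy : Q x <= Q y) by (apply HQ; lra).
  apply (derivable_of_balance Q
    (fun z => stint tau Q (fun u => F u * (Q u - Q z) ^ S j) z y)
    (fun z => mean_kernel h i (S j) z y) x y (mean_kernel (Deriv h) i j x y) md C d j (i + S j));
    try easy.
  - apply HQc. lra.
  (* On a plateau both kernels vanish, so [Hode] gives (y - x) md = 0, against md <> 0. *)
  - destruct Qxy as [L|E]; [easy|exfalso]. destruct (Hz E) as [Z1 Z2].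
    rewrite Z1, Z2, !Rmult_0_r, Rminus_0_r in Hode.
    apply Rmult_integral in Hode. destruct Hode; lra.
  - intros x' Hx'. destruct (Hexp x' Hx') as [Hr He]. split.
    + now apply Hid.
    + rewrite <- H2. exact He.
Qed.

Lemma stint_scal (tau : R) (Q F : R -> R) (c a b : R) :
  mono_above tau Q -> cont_above tau Q -> cont_above tau F -> tau < a -> tau < b ->
  stint tau Q (fun u => c * F u) a b = c * stint tau Q F a b.
Proof.
  intros HQ HQc HF Ha Hb.
  rewrite (stint_ext tau Q _ (fun u => (c - 1) * F u + F u)) by (intros; ring).
  rewrite stint_linear by easy. ring.
Qed.

(** Increments of Q are c times those of the identity, so c passes from the integrator into the
    integrand of the Stieltjes sums. *)
Lemma stint_affine (tau : R) (Q F F' : R -> R) (c a b : R) :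
  mono_above tau Q -> cont_above tau Q -> cont_above tau F -> cont_above tau F' ->
  tau < a -> a < b ->
  (forall u v, a <= u <= b -> a <= v <= b -> Q u - Q v = c * (u - v)) ->
  (forall u, a <= u <= b -> F' u = c * F u) ->
  stint tau Q F a b = stint tau (fun u => u) F' a b.
Proof.
  intros HQ HQc HF HF' Ha Hab HQa HFF.
  apply (RS_integral_unique F' (fun u => u) a b); [easy| |].
  - apply RS_integral_ext with F Q.
    + intros x y z Hx Hy Hz. rewrite HFF, HQa by easy. ring.
    + apply (RS_integral_stint tau Q F Q (fun y => y)); try easy;
        try (intros; apply continuity_pt_idR).
      * intros y Hy. split; [lra|easy].
      * intros y Hy. apply HQc. lra.
  - apply (RS_integral_stint tau (fun u => u) F' (fun u => u) (fun u => u));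
      auto using continuity_pt_idR with cont.
    intros y Hy. split; [lra|easy].
Qed.

(** * The change of variable u = T(y) *)

(** The endpoint limits are stated with thresholds inside the interval, so that l_G and r_G may be
    infinite. *)
Definition time_change (G T : R -> R) (tau : R) : Prop :=
  is_cdf G /\ continuity G /\
  (forall y, in_I G y -> continuity_pt T y) /\
  (forall x y, in_I G x -> in_I G y -> x < y -> T x < T y) /\
  (forall eps, 0 < eps -> exists y0, in_I G y0 /\
     forall y, in_I G y -> y < y0 -> Rabs (T y - tau) < eps) /\
  (forall A, exists y0, in_I G y0 /\ forall y, in_I G y -> y0 < y -> A < T y).

Definition inv_on_I (G T : R -> R) (u : R) : R :=
  epsilon (inhabits 0) (fun y => in_I G y /\ T y = u).

(* The cumulative hazard [RG G] in the variable [u = T y]. *)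
Definition hazard (G T : R -> R) (u : R) : R := RG G (inv_on_I G T u).

Lemma in_I_convex (G : R -> R) (a b y : R) :
  in_I G a -> in_I G b -> a <= y <= b -> in_I G y.
Proof.
  intros [[z [Hz1 Hz2]] _] [_ [w [Hw1 Hw2]]] Hy. split.
  - exists z. split; [easy|lra].
  - exists w. split; [easy|lra].
Qed.

Lemma in_I_open (G : R -> R) (y : R) :
  in_I G y -> exists a b, a < y < b /\ in_I G a /\ in_I G b.
Proof.
  intros [[z [Hz1 Hz2]] [w [Hw1 Hw2]]].
  exists ((z + y) / 2), ((y + w) / 2). split; [lra|].
  split; split; try (exists z; split; [easy|lra]); exists w; split; easy || lra.
Qed.

Lemma in_I_cdf (G : R -> R) (y : R) : is_cdf G -> in_I G y -> 0 < G y < 1.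
Proof.
  intros [Hm _] [[z [Hz1 Hz2]] [w [Hw1 Hw2]]].
  assert (G z <= G y) by (apply Hm; lra). assert (G y <= G w) by (apply Hm; lra). lra.
Qed.

Lemma RG_mono (G : R -> R) (x y : R) :
  is_cdf G -> in_I G y -> x <= y -> RG G x <= RG G y.
Proof.
  intros HG Hy Hxy. assert (Hy' := in_I_cdf G y HG Hy).
  assert (G x <= G y) by now apply HG.
  unfold RG. apply Ropp_le_contravar. apply ln_le; lra.
Qed.

Lemma RG_continuity (G : R -> R) (y : R) :
  is_cdf G -> continuity G -> in_I G y -> continuity_pt (RG G) y.
Proof.
  intros HG HGc Hy. assert (Hy' := in_I_cdf G y HG Hy).
  apply (continuity_pt_opp (fun y => ln (1 - G y))).
  apply (continuity_pt_comp (fun y => 1 - G y) ln).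
  - apply (continuity_pt_minus (fun _ => 1) G); [|apply HGc].
    apply continuity_pt_const. now intros ? ?.
  - apply derivable_continuous_pt. exists (/ (1 - G y)). apply derivable_pt_lim_ln. lra.
Qed.

Lemma RG_pos (G : R -> R) (y : R) : is_cdf G -> in_I G y -> 0 < RG G y.
Proof.
  intros HG Hy. assert (Hy' := in_I_cdf G y HG Hy). unfold RG.
  assert (ln (1 - G y) < ln 1) by (apply ln_increasing; lra). rewrite ln_1 in *. lra.
Qed.

Lemma T_le (G T : R -> R) (tau x y : R) :
  time_change G T tau -> in_I G x -> in_I G y -> x <= y -> T x <= T y.
Proof.
  intros (_ & _ & _ & HT & _) Hx Hy [L| ->]; [left; now apply HT|lra].
Qed.

(** The interval is open, so some a < y belongs to it; if T(y) <= tau, then T would stay below tau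
    by at least T(y) - T(a) on all points left of a. *)
Lemma T_gt_tau (G T : R -> R) (tau y : R) : time_change G T tau -> in_I G y -> tau < T y.
Proof.
  intros (_ & _ & _ & HT & Htau & _) Hy.
  destruct (in_I_open G y Hy) as (a & a1 & Ha & HIa & _).
  apply Rnot_le_lt. intros Hle.
  assert (Hay : T a < T y) by (apply HT; easy || lra).
  destruct (Htau (T y - T a)) as (y0 & Hy0 & H); [lra|].
  destruct (in_I_open G y0 Hy0) as (b & b1 & Hb & HIb & _).
  assert (HIm : in_I G (Rmin a b)) by (unfold Rmin; now destruct (Rle_dec a b)).
  assert (Hm1 := Rmin_l a b). assert (Hm2 := Rmin_r a b).
  specialize (H (Rmin a b) HIm ltac:(lra)). apply Rabs_def2 in H.
  assert (T (Rmin a b) <= T a).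
  { destruct Hm1 as [L|E]; [left; now apply HT|rewrite E; lra]. }
  lra.
Qed.

Lemma T_surj (G T : R -> R) (tau u : R) :
  time_change G T tau -> tau < u -> exists y, in_I G y /\ T y = u.
Proof.
  intros Htc Hu. assert (Htc' := Htc). destruct Htc' as (_ & _ & HTc & HT & Htau & Hinf).
  destruct (Htau (u - tau)) as (y0 & Hy0 & H0); [lra|].
  destruct (in_I_open G y0 Hy0) as (a & a1 & Ha & HIa & _).
  specialize (H0 a HIa ltac:(lra)). apply Rabs_def2 in H0.
  destruct (Hinf u) as (y1 & Hy1 & H1).
  destruct (in_I_open G y1 Hy1) as (b1 & b & Hb & _ & HIb).
  specialize (H1 b HIb ltac:(lra)).
  assert (Hab : a <= b).
  { apply Rnot_lt_le. intros L. assert (T b < T a) by now apply HT. lra. }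
  destruct (IVT_between T a b u Hab) as [z [Hz Ez]]; try lra.
  - intros x Hx. apply HTc. now apply in_I_convex with a b.
  - exists z. split; [now apply in_I_convex with a b|easy].
Qed.

Lemma inv_on_I_spec (G T : R -> R) (tau u : R) :
  time_change G T tau -> tau < u -> in_I G (inv_on_I G T u) /\ T (inv_on_I G T u) = u.
Proof.
  intros Htc Hu. apply (epsilon_spec (inhabits 0) (fun y => in_I G y /\ T y = u)).
  now apply T_surj with tau.
Qed.

Lemma T_lt_inv (G T : R -> R) (tau x y : R) :
  time_change G T tau -> in_I G x -> in_I G y -> T x < T y -> x < y.
Proof.
  intros Htc Hx Hy H. apply Rnot_le_lt. intros L.
  assert (T y <= T x) by now apply (T_le G T tau). lra.
Qed.

Lemma hazard_T (G T : R -> R) (tau y : R) :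
  time_change G T tau -> in_I G y -> hazard G T (T y) = RG G y.
Proof.
  intros Htc Hy. unfold hazard. f_equal.
  destruct (inv_on_I_spec G T tau (T y) Htc) as [H1 H2]; [now apply (T_gt_tau G)|].
  destruct Htc as (_ & _ & _ & HT & _).
  destruct (Rtotal_order (inv_on_I G T (T y)) y) as [L|[E|L]]; [|easy|];
    apply HT in L; easy || lra.
Qed.

Lemma hazard_mono (G T : R -> R) (tau : R) :
  time_change G T tau -> mono_above tau (hazard G T).
Proof.
  intros Htc x y Hx [L| ->]; [|lra].
  destruct (T_surj G T tau x Htc Hx) as [a [Ha <-]].
  destruct (T_surj G T tau y Htc) as [b [Hb <-]]; [lra|].
  rewrite !(hazard_T G T tau) by easy. apply RG_mono; [apply Htc|easy|].
  left. now apply (T_lt_inv G T tau).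
Qed.

(** Continuity of the inverse of T is not passed through: a neighbourhood (a', b') of y on which R
    is controlled has T-image containing (T(a'), T(b')), and monotonicity of T pulls that interval
    back. *)
Lemma hazard_cont (G T : R -> R) (tau : R) :
  time_change G T tau -> cont_above tau (hazard G T).
Proof.
  intros Htc u Hu eps He.
  destruct (T_surj G T tau u Htc Hu) as [y [Hy Ey]].
  assert (Hc : continuity_pt (RG G) y) by (apply RG_continuity; [apply Htc|apply Htc|easy]).
  destruct (Hc eps He) as [d [Hd H]]. 
  destruct (in_I_open G y Hy) as (a & b & Hab & HIa & HIb).
  set (a' := Rmax a (y - d / 2)). set (b' := Rmin b (y + d / 2)).
  assert (Ha' : a <= a' < y /\ y - d / 2 <= a')
    by (unfold a', Rmax; destruct (Rle_dec a (y - d / 2)); lra).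
  assert (Hb' : y < b' <= b /\ b' <= y + d / 2)
    by (unfold b', Rmin; destruct (Rle_dec b (y + d / 2)); lra).
  assert (HIa' : in_I G a') by (apply in_I_convex with a y; easy || lra).
  assert (HIb' : in_I G b') by (apply in_I_convex with y b; easy || lra).
  assert (HTs := proj1 (proj2 (proj2 (proj2 Htc)))).
  assert (H1 : T a' < u) by (rewrite <- Ey; apply HTs; easy || lra).
  assert (H2 : u < T b') by (rewrite <- Ey; apply HTs; easy || lra).
  exists (Rmin (u - T a') (T b' - u)). split; [apply Rmin_pos; lra|].
  intros v [_ Hv]. simpl in *. unfold Rdist in *.
  assert (M1 := Rmin_l (u - T a') (T b' - u)). assert (M2 := Rmin_r (u - T a') (T b' - u)).
  apply Rabs_def2 in Hv.
  assert (Htau' := T_gt_tau G T tau a' Htc HIa').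
  destruct (T_surj G T tau v Htc) as [z [Hz Ez]]; [lra|].
  rewrite <- Ez, <- Ey, !(hazard_T G T tau) by easy.
  destruct (Req_dec z y) as [->|N]; [rewrite Rminus_diag_eq, Rabs_R0; easy|].
  apply H. split; [split; [easy|now apply not_eq_sym]|].
  assert (a' < z) by (apply (T_lt_inv G T tau); easy || lra).
  assert (z < b') by (apply (T_lt_inv G T tau); easy || lra).
  apply Rabs_def1; lra.
Qed.

(** Continuity of G rules out an atom at l_G; this is what makes the cumulative hazard start from 0
    at tau. *)
Lemma in_I_small_cdf (G : R -> R) (eps y : R) :
  is_cdf G -> continuity G -> in_I G y -> 0 < eps ->
  exists z, in_I G z /\ G z < eps.
Proof.
  intros HG HGc Hy He. assert (Hy' := in_I_cdf G y HG Hy).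
  destruct (Rlt_le_dec (G y) eps) as [L|L]; [now exists y|].
  assert (HG' := HG). destruct HG' as (Hm & _ & H0 & _).
  destruct (H0 (eps / 4)) as [A HA]; [lra|].
  set (a := Rmin (A - 1) y).
  assert (Ha1 : a < A) by (unfold a; assert (H := Rmin_l (A - 1) y); lra).
  assert (Ha2 : a <= y) by apply Rmin_r.
  specialize (HA a Ha1). apply Rabs_def2 in HA.
  (* Two levels are taken because z must lie strictly to the right of a point with G > 0: the point
     at level eps / 4 is that witness. *)
  destruct (IVT_between G a y (eps / 2)) as [z [Hz Ez]]; try lra; [intros; apply HGc|].
  destruct (IVT_between G a y (eps / 4)) as [w [Hw Ew]]; try lra; [intros; apply HGc|].
  exists z. split; [|lra]. split.
  - exists w. split; [lra|]. apply Rnot_le_lt. intros Hzw.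
    assert (G z <= G w) by now apply Hm. lra.
  - destruct Hy as [_ [v [Hv1 Hv2]]]. exists v. split; [easy|lra].
Qed.

Lemma hazard_lim (G T : R -> R) (tau : R) :
  time_change G T tau -> right_lim (hazard G T) tau 0.
Proof.
  intros Htc eps He. assert (Htc' := Htc). destruct Htc' as (HG & HGc & _ & _ & _ & Hinf).
  destruct (Hinf 0) as (y0 & Hy0 & _).
  assert (Hexp : exp (- eps) < 1) by (rewrite <- exp_0; apply exp_increasing; lra).
  destruct (in_I_small_cdf G (1 - exp (- eps)) y0 HG HGc Hy0) as [z [Hz Hzs]]; [lra|].
  assert (Hz' := in_I_cdf G z HG Hz).
  assert (HR : RG G z < eps).
  { unfold RG. assert (H : ln (exp (- eps)) < ln (1 - G z))
      by (apply ln_increasing; [apply exp_pos|lra]).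
    rewrite ln_exp in H. lra. }
  exists (T z - tau). split; [assert (H := T_gt_tau G T tau z Htc Hz); lra|].
  intros u Hu. destruct (T_surj G T tau u Htc) as [y [Hy Ey]]; [lra|].
  rewrite <- Ey, (hazard_T G T tau), Rminus_0_r by easy.
  assert (Hp := RG_pos G y HG Hy).
  assert (RG G y <= RG G z).
  { apply RG_mono; try easy. left. apply (T_lt_inv G T tau); easy || lra. }
  rewrite Rabs_pos_eq; lra.
Qed.

(** * Conditional expectations as integrals against dQ *)

Lemma CondExp_stint (G T phi : R -> R) (tau s t : R) (a b : nat) :
  time_change G T tau -> cont_above tau phi -> in_I G s -> in_I G t -> s < t ->
  CondExp (S a) (S b) G (fun x => phi (T x)) s t =
    INR (fact (S (a + b))) / (INR (fact a) * INR (fact b)) *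
    (stint tau (hazard G T) (fun u => phi u * (hazard G T (T t) - hazard G T u) ^ b
                               * (hazard G T u - hazard G T (T s)) ^ a) (T s) (T t)
     / (hazard G T (T t) - hazard G T (T s)) ^ S (a + b)).
Proof.
  intros Htc Hphi Hs Ht Hst.
  assert (HQ := hazard_mono G T tau Htc). assert (HQc := hazard_cont G T tau Htc).
  set (Q := hazard G T) in *. set (x := T s). set (y := T t).
  set (C := INR (fact (S (a + b))) / (INR (fact a) * INR (fact b))).
  set (F := fun u => phi u * (Q y - Q u) ^ b * (Q u - Q x) ^ a).
  assert (HF : cont_above tau F) by (unfold F; auto 15 with cont).
  assert (Hx : tau < x) by (apply (T_gt_tau G); easy).
  assert (Hy : tau < y) by (apply (T_gt_tau G); easy).
  assert (HI : forall z, s <= z <= t -> in_I G z) by (intros; now apply in_I_convex with s t).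
  assert (HRS : RS_integral (fun z => phi (T z) * cond_weight (S a) (S b) G s t z) (RG G) s t
     (C / (Q y - Q x) ^ S (a + b) * stint tau Q F x y)).
  { rewrite <- stint_scal by easy.
    apply RS_integral_ext with (fun z => C / (Q y - Q x) ^ S (a + b) * F (T z)) (RG G).
    (* The exponents a and b of the two quotients and the final division add up to a + b + 1. Only
       laws of the total inverse are used, so plateaus are covered, where both weights are 0. *)
    - intros z z1 z2 Hz _ _. f_equal. unfold cond_weight, F.
      replace (S a + S b - 1)%nat with (S (a + b)) by lia.
      replace (S a - 1)%nat with a by lia. replace (S b - 1)%nat with b by lia.
      fold C. unfold Q, x, y. rewrite !(hazard_T G T tau) by auto.
      simpl pow. rewrite pow_add. unfold Rdiv. rewrite !Rinv_mult, !Rpow_mult_distr, !pow_inv. ring.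
    - apply (RS_integral_stint tau Q (fun u => C / (Q y - Q x) ^ S (a + b) * F u) (RG G) T);
        try easy.
      + auto with cont.
      + intros z Hz. split; [apply (T_gt_tau G); auto|]. apply (hazard_T G T tau); auto.
      + intros z Hz. apply Htc; auto.
      + intros z Hz. apply RG_continuity; [apply Htc|apply Htc|auto].
      + intros z z' H1 H2 H3. apply (T_le G T tau); try easy; apply HI; lra. }
  transitivity (C / (Q y - Q x) ^ S (a + b) * stint tau Q F x y); [|unfold Rdiv; ring].
  refine (RS_integral_unique _ _ s t _ _ Hst _ HRS).
  apply (epsilon_spec (inhabits 0) (RS_integral
    (fun z => phi (T z) * cond_weight (S a) (S b) G s t z) (RG G) s t)).
  now eexists; exact HRS.
Qed.

(** The slope cancels: the powers contribute c^(a+b), dQ one more c, and the denominator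
    c^(a+b+1). *)
Lemma CondExp_mean_kernel_affine (G T h : R -> R) (tau c s t : R) (a b : nat) :
  time_change G T tau -> smooth_above tau (b + a + 1) h -> 0 < c ->
  (forall u, tau < u -> hazard G T u = c * (u - tau)) ->
  in_I G s -> in_I G t -> s < t ->
  CondExp (S a) (S b) G (fun x => Dn (b + a + 1) h (T x)) s t =
    INR (fact (S (a + b))) / (INR (fact a) * INR (fact b)) * mean_kernel h b a (T s) (T t).
Proof.
  intros Htc Hh Hc HQ Hs Ht Hst.
  assert (Hphi := smooth_above_cont tau _ _ h Hh (Nat.le_refl _)).
  assert (Hx : tau < T s) by (apply (T_gt_tau G); easy).
  assert (Hxy : T s < T t) by (apply Htc; easy).
  rewrite (CondExp_stint G T _ tau) by easy. f_equal.
  rewrite (mean_kernel_stint tau (b + a + 1)) by (easy || lia).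
  assert (HQm := hazard_mono G T tau Htc). assert (HQc := hazard_cont G T tau Htc).
  rewrite (stint_affine tau (hazard G T) _ (fun u => c ^ S (a + b) *
      (Dn (b + a + 1) h u * (T t - u) ^ b * (u - T s) ^ a)) c); try easy.
  - rewrite stint_scal by (easy || lra || auto 15 with cont).
    rewrite !HQ by lra. rewrite (Nat.add_comm b a).
    replace (c * (T t - tau) - c * (T s - tau)) with (c * (T t - T s)) by ring.
    rewrite Rpow_mult_distr. field. split; apply pow_nonzero; lra.
  - auto 15 with cont.
  - auto 15 with cont.
  - intros u v Hu Hv. rewrite !HQ by lra. ring.
  - intros u Hu. rewrite !HQ by lra.
    replace (c * (T t - tau) - c * (u - tau)) with (c * (T t - u)) by ring.
    replace (c * (u - tau) - c * (T s - tau)) with (c * (u - T s)) by ring.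
    rewrite !Rpow_mult_distr. simpl pow. rewrite pow_add. ring.
Qed.

Lemma stint_of_CondExp (G T phi : R -> R) (tau s t m : R) (a b : nat) :
  time_change G T tau -> cont_above tau phi -> in_I G s -> in_I G t -> s < t ->
  CondExp (S a) (S b) G (fun x => phi (T x)) s t =
    INR (fact (S (a + b))) / (INR (fact a) * INR (fact b)) * m ->
  (hazard G T (T s) = hazard G T (T t) -> m = 0) /\
  stint tau (hazard G T) (fun u => phi u * (hazard G T (T t) - hazard G T u) ^ b
                               * (hazard G T u - hazard G T (T s)) ^ a) (T s) (T t)
  = (hazard G T (T t) - hazard G T (T s)) ^ S (a + b) * m.
Proof.
  intros Htc Hphi Hs Ht Hst E. rewrite (CondExp_stint G T phi tau) in E by easy.
  assert (HQ := hazard_mono G T tau Htc). assert (HQc := hazard_cont G T tau Htc).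
  apply Rmult_eq_reg_l in E.
  2:{ apply Rgt_not_eq, Rdiv_lt_0_compat; [|apply Rmult_lt_0_compat]; apply INR_fact_lt_0. }
  assert (Hx : tau < T s) by (apply (T_gt_tau G); easy).
  assert (Hxy : T s < T t) by (apply Htc; easy).
  set (Q := hazard G T) in *.
  set (F := fun u => phi u * (Q (T t) - Q u) ^ b * (Q u - Q (T s)) ^ a) in *.
  assert (HF : cont_above tau F) by (unfold F; auto 15 with cont).
  (* On a plateau the conditional expectation is 0 by the convention on division, hence m = 0; the
     integral is 0 as well, since dQ has no mass on the interval. *)
  destruct (Req_dec (Q (T t) - Q (T s)) 0) as [Z|NZ].
  - rewrite Z in E |- *. rewrite pow_i in E |- * by lia.
    unfold Rdiv in E. rewrite Rinv_0, Rmult_0_r in E. split; [easy|].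
    rewrite <- E, Rmult_0_r.
    destruct (continuous_bounded F (T s) (T t)) as [K [_ HK]];
      [lra|intros; apply HF; lra|].
    assert (B := stint_bound tau Q F (T s) (T t) K HQ HQc HF Hx ltac:(lra)).
    rewrite Rmin_left, Rmax_right, Z, Rabs_R0, Rmult_0_r in B by lra.
    specialize (B HK). apply Rcomplements.Rabs_eq_0.
    assert (0 <= Rabs (stint tau Q F (T s) (T t))) by apply Rabs_pos. lra.
  - split; [lra|]. rewrite <- E. field. now apply pow_nonzero.
Qed.

Lemma smooth_above_Deriv (tau : R) (n : nat) (h : R -> R) :
  smooth_above tau (S n) h -> smooth_above tau n (Deriv h).
Proof.
  intros [H1 H2]. split; [|now rewrite Dn_Deriv].
  intros l z Hl Hz. rewrite !Dn_Deriv. apply H1; [lia|easy].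
Qed.

Lemma hazard_linear_of_identities (G T h : R -> R) (tau : R) (i j : nat) :
  time_change G T tau -> smooth_above tau (i + S j + 1) h ->
  (forall t, in_I G t -> exists L, L <> 0 /\
     right_lim (fun x => Dxy (S i) (S j) (M h) x (T t)) tau L) ->
  (forall s t, in_I G s -> in_I G t -> s < t ->
     CondExp (S (S j)) (S i) G (fun x => Dn (i + S j + 1) h (T x)) s t =
     INR (fact (S (S j + i))) / (INR (fact (S j)) * INR (fact i)) *
       mean_kernel h i (S j) (T s) (T t)) ->
  (forall s t, in_I G s -> in_I G t -> s < t ->
     CondExp (S j) (S i) G (fun x => Dn (i + S j + 1) h (T x)) s t =
     INR (fact (S (j + i))) / (INR (fact j) * INR (fact i)) *
       mean_kernel (Deriv h) i j (T s) (T t)) ->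
  exists c, forall u, tau < u -> hazard G T u = c * (u - tau).
Proof.
  intros Htc Hs Hnz H1 H2.
  assert (HQ := hazard_mono G T tau Htc). assert (HQc := hazard_cont G T tau Htc).
  assert (Hphi := smooth_above_cont tau _ _ h Hs (Nat.le_refl _)).
  apply linear_of_local_secant; [now apply hazard_lim|].
  intros y Hy. destruct (T_surj G T tau y Htc Hy) as [t [Ht <-]].
  destruct (Hnz t Ht) as [L [HL Hlim]].
  (* With tolerance |L| the derivative stays away from 0 on a right neighbourhood of tau, whose
     width depends on t. *)
  destruct (Hlim (Rabs L)) as [d [Hd Hx]]; [now apply Rabs_pos_lt|].
  exists d. split; [easy|]. intros x Hxd Hxt.
  apply (derivable_of_stint_identities tau (hazard G T) h i j); try easy.
  - intros z Hz. destruct (T_surj G T tau z Htc) as [s [Hs' <-]]; [lra|].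
    assert (Hst : s < t) by (apply (T_lt_inv G T tau); easy || lra).
    destruct (stint_of_CondExp G T _ tau s t _ (S j) i Htc Hphi Hs' Ht Hst (H1 s t Hs' Ht Hst))
      as [A1 A2].
    destruct (stint_of_CondExp G T _ tau s t _ j i Htc Hphi Hs' Ht Hst (H2 s t Hs' Ht Hst))
      as [B1 B2].
    split; [auto|]. split.
    + rewrite A2. now replace (S j + i)%nat with (i + S j)%nat by lia.
    + rewrite B2. now replace (S (j + i)) with (i + S j)%nat by lia.
  - destruct (mean_kernel_derive_secant tau h i j x (T t) Hs) as [md [Hmd _]]; [lra|].
    rewrite (Deriv_eq _ _ _ Hmd). intros Z.
    specialize (Hx x ltac:(lra)).
    (* [Dxy] applies the x-derivatives last, so the outermost one acts on [Dxy i (S j)], which is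
       the kernel near x; this remains valid although the kernel formula itself stops one order
       earlier. *)
    assert (E : Dxy (S i) (S j) (M h) x (T t) = md).
    { change (Deriv (fun x => Dxy i (S j) (M h) x (T t)) x = md). apply Deriv_eq.
      revert Hmd. apply derivable_pt_lim_ext_loc.
      eapply filter_imp; [|apply (locally_open_interval tau (T t)); lra].
      intros z Hz. symmetry. apply Dxy_M_mean_kernel with tau (i + S j + 1)%nat; easy || lia || lra. }
    rewrite E, Z, Rminus_0_l, Rabs_Ropp in Hx. lra.
Qed.

Theorem mainTheorem9 (n r k : nat) (G T h : R -> R) (tau : R)
  (Hn : (3 <= n)%nat) (Hr : (2 <= r)%nat) (Hk2 : (2 <= k)%nat) (Hkn : (k <= n - 1)%nat)
  (* (i) *)
  (HG : is_cdf G) (HGc : continuity G)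
  (* (ii) *)
  (HTc : forall y, in_I G y -> continuity_pt T y)
  (HTinc : forall x y, in_I G x -> in_I G y -> x < y -> T x < T y)
  (Htau : forall eps, 0 < eps -> exists y0, in_I G y0 /\
            forall y, in_I G y -> y < y0 -> Rabs (T y - tau) < eps)
  (HTinf : forall A, exists y0, in_I G y0 /\
            forall y, in_I G y -> y0 < y -> A < T y)
  (* (iii) *)
  (Hhd : forall (j : nat) (x : R), (j < k + r - 1)%nat -> tau < x ->
            exists l, derivable_pt_lim (Dn j h) x l)
  (Hhc : forall x, tau < x -> continuity_pt (Dn (k + r - 1) h) x)
  (* rM_{k-1}(tau, T(t)) <> 0 *)
  (Hnz : forall t, in_I G t -> exists L, L <> 0 /\
            right_lim (fun x => Dxy r (k - 1) (M h) x (T t)) tau L) :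
  ((forall s t, in_I G s -> in_I G t -> s < t ->
      CondExp k r G (fun x => Dn (k + r - 1) h (T x)) s t =
      INR (fact (k + r - 1)) / (INR (fact (k - 1)) * INR (fact (r - 1))) *
        Dxy (r - 1) (k - 1) (M h) (T s) (T t))
   /\
   (forall s2 t, in_I G s2 -> in_I G t -> s2 < t ->
      CondExp (k - 1) r G (fun x => Dn (k + r - 1) h (T x)) s2 t =
      INR (fact (k + r - 2)) / (INR (fact (k - 2)) * INR (fact (r - 1))) *
        Dxy (r - 1) (k - 2) (M' h) (T s2) (T t)))
  <->
  (exists c, 0 < c /\ forall y, in_I G y -> G y = 1 - exp (- (c * (T y - tau)))).
Proof.
  assert (Htc : time_change G T tau) by (repeat split; easy || apply HG).
  (* With k = j + 2 and r = i + 1, the order k + r - 1 is i + (j + 1) + 1, and the two identities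
     concern the exponents j + 1 and j. *)
  destruct k as [|[|j]]; [lia|lia|]. destruct r as [|i]; [lia|].
  replace (S (S j) + S i - 1)%nat with (i + S j + 1)%nat in * by lia.
  replace (S (S j) - 1)%nat with (S j) in * by lia.
  replace (S i - 1)%nat with i in * by lia.
  replace (S (S j) - 2)%nat with j in * by lia.
  replace (S (S j) + S i - 2)%nat with (S (j + i)) in * by lia.
  assert (Hs : smooth_above tau (i + S j + 1) h).
  { split; [|exact Hhc]. intros l x Hl Hx. destruct (Hhd l x Hl Hx) as [d Hd].
    simpl. now rewrite (Deriv_eq _ _ _ Hd). }
  assert (Hs' : smooth_above tau (i + j + 1) (Deriv h)).
  { apply smooth_above_Deriv. now replace (S (i + j + 1)) with (i + S j + 1)%nat by lia. }
  assert (ED : forall s t, in_I G s -> in_I G t -> s < t ->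
    Dxy i (S j) (M h) (T s) (T t) = mean_kernel h i (S j) (T s) (T t) /\
    Dxy i j (M' h) (T s) (T t) = mean_kernel (Deriv h) i j (T s) (T t)).
  { intros s t Hss Ht Hst.
    assert (H1 : tau < T s) by (apply (T_gt_tau G); easy).
    assert (H2 : T s < T t) by (apply HTinc; easy). split.
    - apply Dxy_M_mean_kernel with tau (i + S j + 1)%nat; easy || lia.
    - apply (Dxy_M_mean_kernel tau (i + j + 1) (Deriv h)); easy || lia. }
  split.
  - intros [H1 H2].
    destruct (hazard_linear_of_identities G T h tau i j Htc Hs Hnz) as [c Hc].
    + intros s t Hss Ht Hst. rewrite (H1 s t Hss Ht Hst).
      replace (i + S j + 1)%nat with (S (S j + i)) by lia. now rewrite (proj1 (ED s t Hss Ht Hst)).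
    + intros s t Hss Ht Hst. rewrite (H2 s t Hss Ht Hst).
      now rewrite (proj2 (ED s t Hss Ht Hst)).
    + exists c.
      assert (HR : forall y, in_I G y -> RG G y = c * (T y - tau)).
      { intros y Hy. rewrite <- (hazard_T G T tau) by easy. apply Hc. now apply (T_gt_tau G). }
      split.
      (* The limit at r_G serves to supply a point of the interval; there both R and T - tau are
         positive, hence so is c. *)
      * destruct (HTinf 0) as (y0 & Hy0 & _).
        assert (H3 := RG_pos G y0 HG Hy0). rewrite HR in H3 by easy.
        assert (H4 := T_gt_tau G T tau y0 Htc Hy0).
        apply Rmult_lt_reg_r with (T y0 - tau); lra.
      * intros y Hy. rewrite <- HR by easy. unfold RG. rewrite Ropp_involutive, exp_ln; [ring|].
        assert (H3 := in_I_cdf G y HG Hy). lra.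
  - intros (c & Hc & HGe).
    assert (HQ : forall u, tau < u -> hazard G T u = c * (u - tau)).
    { intros u Hu. destruct (T_surj G T tau u Htc Hu) as [y [Hy <-]].
      rewrite (hazard_T G T tau) by easy. unfold RG. rewrite HGe by easy.
      replace (1 - (1 - exp (- (c * (T y - tau))))) with (exp (- (c * (T y - tau)))) by ring.
      rewrite ln_exp. ring. }
    split; intros s t Hss Ht Hst; destruct (ED s t Hss Ht Hst) as [E1 E2].
    + rewrite E1, (CondExp_mean_kernel_affine G T h tau c s t (S j) i) by easy.
      now replace (S (S j + i)) with (i + S j + 1)%nat by lia.
    + rewrite E2.
      (* Since h^(k+r-1) = (h')^(k+r-2), the second identity is the affine computation for h' with
         the exponent lowered by one. *)
      assert (EDn : Dn (i + S j + 1) h = Dn (i + j + 1) (Deriv h)).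
      { rewrite Dn_Deriv. f_equal. lia. }
      rewrite EDn. now apply (CondExp_mean_kernel_affine G T (Deriv h) tau c s t j i).
Qed.
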